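(* Let $p\ge 0$ and $m\ge 1$ be integers and let $z$ be a real number with $0<z<1$. Then $$\sum_{n=1}^{\infty} \frac{\zeta(2n+1)z^{2n}}{(2n+1)\cdots(2n+m)(2n+m+1+p)} = -\sum_{k=0}^{p} \frac{p!\,(-1)^k\,\psi^{(-k-m-1)}(z)}{(p-k)!\,z^{m+k+1}}$$ $$\qquad+\frac{(-1)^m p!}{2z}\bigg(\sum_{k=m}^{m+p} \frac{(-1)^{\lfloor \frac{k+1}{2} \rfloor}}{(p+m-k)!\,(2\pi z)^k}\,\mathrm{Cl}_{k+1}(2\pi z) - \delta_{\lfloor \frac{p+m}{2} \rfloor, \frac{p+m}{2}}\frac{(-1)^{\frac{p+m}{2}}\zeta(p+m+1)}{(2\pi z)^{p+m}}\bigg)$$ $$\qquad-\frac{1}{2z}\sum_{k=1}^{\lfloor \frac{m-1}{2} \rfloor} \frac{(-1)^k\,\zeta(2k+1)}{(m-1-2k)!\,(m+p-2k)\,(2\pi z)^{2k}}+\frac{\log(2\pi/z)+H_{m-1}}{2z\,(m-1)!\,(p+m)}+\frac{1}{2z\,(m-1)!\,(p+m)^2}-\frac{\gamma}{m!\,(p+m+1)}.$$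
   Context: The denominator on the left is $\prod_{i=1}^{m}(2n+i)\cdot(2n+m+1+p)$. The negapolygammas are $\psi^{(-1)}(z)=\log\Gamma(z)$ and, for $n\ge2$, $\psi^{(-n)}(z)=\frac{1}{(n-2)!}\int_0^z (z-t)^{n-2}\log\Gamma(t)\,dt$. The generalized Clausen functions of a real variable $\theta$ are $\mathrm{Cl}_{2j}(\theta)=\sum_{k=1}^\infty \frac{\sin(k\theta)}{k^{2j}}$ for $j\ge1$ and $\mathrm{Cl}_{2j+1}(\theta)=\sum_{k=1}^\infty \frac{\cos(k\theta)}{k^{2j+1}}$ for $j\ge0$. $\zeta$ is the Riemann zeta function, $\gamma$ is the Euler–Mascheroni constant, and $H_k=\sum_{i=1}^k\frac1i$ is the $k$-th harmonic number, $H_0=0$. $\delta_{a,b}$ is the Kronecker delta, so $\delta_{\lfloor n/2\rfloor,n/2}$ is $1$ if $n$ is even and $0$ if $n$ is odd; a term multiplied by it is read as $0$ when $n$ is odd. Empty sums are $0$. *)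

(* Defs.v *)
(* Concrete real numbers of Stdlib, with Coquelicot. *)
From Stdlib Require Import Arith Factorial Reals.
From Coquelicot Require Import Coquelicot.
Open Scope R_scope.

(* Dirichlet series; meaningful for [1 < s]. *)
Definition zeta (s : R) : R := Series (fun k => / Rpower (INR (S k)) s).

(* Euler's integral; meaningful for [0 < x]. *)
Definition Gamma (x : R) : R :=
  RInt_gen (fun t => Rpower t (x - 1) * exp (- t))
    (at_right 0) (Rbar_locally p_infty).

Definition logGamma (x : R) : R := ln (Gamma x).

(* [negapolygamma n z] is psi^(-n)(z), for [1 <= n] and [0 < z]; the value at
   [n = 0] is a dummy.  The integral is improper at 0, where [logGamma] has a
   logarithmic singularity. *)
Definition negapolygamma (n : nat) (z : R) : R :=
  match n with
  | O => 0
  | 1%nat => logGamma z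
  | S (S j) =>
      / INR (fact j) *
      RInt_gen (fun t => (z - t) ^ j * logGamma t) (at_right 0) (at_point z)
  end.

(* Sine series for even index, cosine series for odd index ([1 <= n]). *)
Definition Clausen (n : nat) (theta : R) : R :=
  if Nat.even n
  then Series (fun k => sin (INR (S k) * theta) / INR (S k) ^ n)
  else Series (fun k => cos (INR (S k) * theta) / INR (S k) ^ n).

(* [sum_n_m f a b] is 0 when [b < a], so [harmonic 0 = 0]. *)
Definition harmonic (k : nat) : R := sum_n_m (fun i => / INR i) 1 k.

Definition EulerMascheroni : R :=
  real (Lim_seq (fun n => harmonic n - ln (INR n))).

(* On reals, since delta_{floor(n/2), n/2} compares [n/2] with its floor. *)
Definition kronecker (a b : R) : R := if Req_EM_T a b then 1 else 0.

(* (2n+1)...(2n+m) for [1 <= m]: [prod_f_R0 f N] multiplies [f 0], ..., [f N]. *)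
Definition shifted_product (n m : nat) : R :=
  prod_f_R0 (fun i => INR (2 * n + S i)) (m - 1).

(* Main.v *)
Require Import Defs.
From Stdlib Require Import Arith Factorial Reals.
From Stdlib Require Import Ranalysis5 Lra Lia Psatz.
From Coquelicot Require Import Coquelicot.
Open Scope R_scope.

(** Everything rests on one closed form on (0, 1): the iterated integrals of
    log Gamma split into elementary chains of antiderivatives.

    Expanding each odd zeta value as a Dirichlet series and exchanging the two
    sums, with u = z / k,
      sum_n zeta(2n+1) z^(2n+1) / (2n+1) = sum_k (ln(1+u) - ln(1-u)) / 2 - u
        = sum_k (ln(1+u) - u) - 1/2 sum_k ln(1-u^2).
    The first sum on the right is the logarithm of the Weierstrass product of
    Gamma ([is_series_logGamma]) and the second one that of Euler's sine product
    ([is_series_ln_sine_product]).  The result, [is_series_odd_zeta], expresses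
    log Gamma through this odd zeta series, through linear and constant terms,
    through ln z, and through - ln (2 sin (PI z)), which is the derivative of the
    second Clausen function up to scaling ([is_derive_Clausen_2]).

    Each of these pieces is the first entry of a sequence of functions in which
    every entry is the derivative of the next ([derivative_chain]); integration
    constants are chosen so that from the second entry on the sum of all pieces
    vanishes at 0+.  For the Clausen piece this forces the polynomials with odd
    zeta coefficients called [correction_chain].  The iterated integrals of log
    Gamma are then the entries of the summed chain ([negapolygamma_eq]).

    The sum of negapolygammas in the theorem is, up to a power of z, the
    repeated integration by parts of z^p against the m-th entry of this chain.
    Its derivative is z^p times that entry ([is_derive_by_parts]), and this can
    also be integrated piece by piece: the zeta series acquires the factor
    1 / (2n+m+1+p), which produces the series of the theorem, the powers and
    the logarithm give the elementary terms, the Clausen chain is again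
    integrated by parts and leaves a constant at 0, which is the Kronecker delta
    term.  Two antiderivatives with the same limit at 0+ agree, which is
    [by_parts_negapolygamma]; the theorem is this identity divided by
    z^(m+p+1). *)

(** * Real-analysis preliminaries *)

(** Algebraic tactics fail on equations whose type is a Coquelicot structure
    over R; this exposes the underlying type. *)
Ltac real_eq := match goal with |- @eq _ ?a ?b => change (@eq R a b) end.

Lemma le_div_of_mul_le a b c : 0 < c -> a * c <= b -> a <= b / c.
Proof. intros Hc H. apply (Rle_div_r a b c); auto. Qed.

Lemma div_le_of_le_mul a b c : 0 < c -> a <= b * c -> a / c <= b.
Proof. intros Hc H. apply (Rle_div_l a b c); auto. Qed.

Lemma sum_n_S (f : nat -> R) n : @eq R (sum_n f (S n)) (sum_n f n + f (S n)).
Proof. exact (sum_Sn f n). Qed.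

Lemma is_series_of_lim (f : nat -> R) (l : R) : is_lim_seq (sum_n f) l -> is_series f l.
Proof. intros H; exact H. Qed.

Lemma lim_of_is_series (f : nat -> R) (l : R) : is_series f l -> is_lim_seq (sum_n f) l.
Proof. intros H; exact H. Qed.

(** * The sine product *)

Definition cos_moment (n : nat) (x : R) : R :=
  RInt (fun t => cos (x * t) * cos t ^ n) 0 (PI / 2).

Lemma continuous_of_derive (f : R -> R) x : ex_derive f x -> continuous f x.
Proof. exact (ex_derive_continuous f x). Qed.

Lemma continuity_pt_of_derive (f : R -> R) x : ex_derive f x -> continuity_pt f x.
Proof. intros H. apply continuity_pt_filterlim, (ex_derive_continuous f x H). Qed.

Lemma ex_RInt_cos_moment n x : ex_RInt (fun t => cos (x * t) * cos t ^ n) 0 (PI / 2).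
Proof.
  apply (ex_RInt_continuous (V := R_CompleteNormedModule)); intros t _.
  apply continuous_of_derive. auto_derive; auto.
Qed.

Lemma is_RInt_of_derive (f df : R -> R) a b :
  (forall t, is_derive f t (df t)) -> (forall t, continuous df t) ->
  is_RInt df a b (f b - f a).
Proof.
  intros H1 H2. apply (is_RInt_derive f df); auto.
Qed.

Lemma is_RInt_ext_R (f g : R -> R) a b (l : R) :
  (forall t, f t = g t) -> is_RInt f a b l -> is_RInt g a b l.
Proof. intros H. apply is_RInt_ext. intros t _. apply H. Qed.

Lemma is_RInt_uniq (f : R -> R) a b (l1 l2 : R) :
  is_RInt f a b l1 -> is_RInt f a b l2 -> l1 = l2.
Proof.
  intros H1 H2. rewrite <- (is_RInt_unique (V := R_CompleteNormedModule) f a b l1 H1).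
  exact (is_RInt_unique (V := R_CompleteNormedModule) f a b l2 H2).
Qed.

(** Integrate the derivative of
    n cos(xt) cos^(n-1) t sin t - x sin(xt) cos^n t, which vanishes at both end
    points, with n + 2 in place of n. *)
Lemma cos_moment_step n x :
  (INR (n + 2) ^ 2 - x ^ 2) * cos_moment (n + 2) x
  = INR (n + 2) * INR (n + 1) * cos_moment n x.
Proof.
  assert (H : is_RInt (fun t => (INR (n + 2) ^ 2 - x ^ 2) * (cos (x * t) * cos t ^ (n + 2))
      - INR (n + 2) * INR (n + 1) * (cos (x * t) * cos t ^ n)) 0 (PI / 2) 0).
  { set (B := fun t => INR (n + 2) * cos (x * t) * cos t ^ (n + 1) * sin t
                    - x * sin (x * t) * cos t ^ (n + 2)).
    replace 0 with (B (PI / 2) - B 0) at 2.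
    2:{ unfold B. rewrite cos_PI2, !Rmult_0_r, !sin_0.
        rewrite !pow_i by lia. ring. }
    apply is_RInt_of_derive; intros t.
    - unfold B. auto_derive; auto.
      replace (Nat.pred (n + 1)) with n by lia.
      replace (Nat.pred (n + 2)) with (n + 1)%nat by lia.
      rewrite !pow_add. rewrite !plus_INR. simpl (INR 2). simpl (INR 1).
      generalize (sin2_cos2 t). unfold Rsqr. intros E.
      assert (E' : sin t * sin t = 1 - cos t * cos t) by lra.
      ring_simplify. replace (sin t ^ 2) with (1 - cos t * cos t) by (rewrite <- E'; ring).
      ring.
    - apply continuous_of_derive. auto_derive; auto. }
  assert (H' : is_RInt (fun t => (INR (n + 2) ^ 2 - x ^ 2) * (cos (x * t) * cos t ^ (n + 2))
      - INR (n + 2) * INR (n + 1) * (cos (x * t) * cos t ^ n)) 0 (PI / 2)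
      ((INR (n + 2) ^ 2 - x ^ 2) * cos_moment (n + 2) x
        - INR (n + 2) * INR (n + 1) * cos_moment n x)).
  { apply (is_RInt_minus (V := R_NormedModule)).
    - apply (is_RInt_scal (V := R_NormedModule)). apply (RInt_correct (V := R_CompleteNormedModule)), ex_RInt_cos_moment.
    - apply (is_RInt_scal (V := R_NormedModule)). apply (RInt_correct (V := R_CompleteNormedModule)), ex_RInt_cos_moment. }
  generalize (is_RInt_uniq _ _ _ _ _ H H'). lra.
Qed.

Lemma cos_moment_0_pos n : 0 < cos_moment n 0.
Proof.
  assert (HP := PI_RGT_0).
  apply RInt_gt_0; [lra | | ].
  - intros t Ht. rewrite Rmult_0_l, cos_0, Rmult_1_l. apply pow_lt, cos_gt_0; lra.
  - intros t Ht. apply continuous_of_derive. auto_derive; auto.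
Qed.

Lemma t_cos_le_sin t : 0 <= t <= PI / 2 -> t * cos t <= sin t.
Proof.
  intros [H0 H1]. assert (HP := PI_RGT_0).
  destruct (MVT_gen (fun t => sin t - t * cos t) 0 t (fun t => t * sin t)) as [c [Hc E]].
  - intros; auto_derive; auto; ring.
  - intros; apply continuity_pt_of_derive. auto_derive; auto.
  - rewrite Rmin_left, Rmax_right in Hc by lra.
    rewrite sin_0 in E.
    assert (0 <= c * sin c * (t - 0)).
    { apply Rmult_le_pos; [ apply Rmult_le_pos; [lra | apply sin_ge_0; lra] | lra]. }
    lra.
Qed.

Lemma one_minus_cos_le x : 1 - cos x <= x ^ 2 / 2.
Proof.
  replace x with (2 * (x / 2)) at 1 by field.
  rewrite cos_2a_sin.
  assert (Rabs (sin (x / 2)) <= Rabs (x / 2)).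
  { assert (forall y, 0 <= y -> Rabs (sin y) <= y) as P.
    { intros y Hy. destruct (Req_dec y 0) as [->|Hn]. { rewrite sin_0, Rabs_R0; lra. }
      apply Rabs_le. split.
      - destruct (Rle_lt_dec y 1).
        + assert (0 <= sin y); [ apply sin_ge_0; [lra | generalize PI2_1; lra ] | lra].
        + generalize (SIN_bound y); lra.
      - left. apply sin_lt_x; lra. }
    destruct (Rle_lt_dec 0 (x / 2)).
    - rewrite (Rabs_right (x/2)) by lra. auto.
    - rewrite (Rabs_left (x/2)) by lra. rewrite <- Rabs_Ropp, <- sin_neg. apply P; lra. }
  assert (sin (x / 2) ^ 2 <= (x / 2) ^ 2).
  { rewrite <- (pow2_abs (sin _)), <- (pow2_abs (x / 2)). apply pow_incr. split; [apply Rabs_pos | auto]. }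
  simpl in *. lra.
Qed.

(** On [0, PI/2], 1 - cos(xt) <= x^2 t^2 / 2 and t cos t <= sin t, so the defect
    is at most x^2 / 2 times t sin t cos^n t, whose integral is evaluated by the
    antiderivative t cos^(n+1) t. *)
Lemma cos_moment_bounds n x :
  (1 - x ^ 2 / (2 * INR (S n))) * cos_moment (S n) 0 <= cos_moment (S n) x <= cos_moment (S n) 0.
Proof.
  assert (HP := PI_RGT_0).
  assert (Hn : 0 < INR (S n)) by (apply lt_0_INR; lia).
  split.
  - set (c := x ^ 2 / (2 * INR (S n))).
    assert (H : is_RInt (fun t => cos (0 * t) * cos t ^ (S n) - cos (x * t) * cos t ^ (S n)) 0 (PI / 2)
       (cos_moment (S n) 0 - cos_moment (S n) x)).
    { apply (is_RInt_minus (V := R_NormedModule)); apply (RInt_correct (V := R_CompleteNormedModule)), ex_RInt_cos_moment. }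
    assert (H' : is_RInt (fun t => x ^ 2 / 2 * (t * sin t * cos t ^ n)) 0 (PI / 2)
       (c * cos_moment (S n) 0)).
    { apply is_RInt_ext_R with (fun t => c * (cos (0 * t) * cos t ^ (S n)
         - (cos t ^ (S n) - INR (S n) * t * sin t * cos t ^ n))).
      { intros t. rewrite Rmult_0_l, cos_0. unfold c. rewrite <- tech_pow_Rmult. field. lra. }
      apply (is_RInt_scal (V := R_NormedModule)).
      replace (cos_moment (S n) 0) with (cos_moment (S n) 0 - 0) by ring.
      apply (is_RInt_minus (V := R_NormedModule)).
      - apply (RInt_correct (V := R_CompleteNormedModule)), ex_RInt_cos_moment.
      - set (B := fun t => t * cos t ^ (S n)).
        replace 0 with (B (PI / 2) - B 0) at 2.
        2:{ unfold B. rewrite cos_PI2, pow_i by lia. ring. }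
        apply is_RInt_of_derive; intros t.
        + unfold B. auto_derive; auto. change (match n with O => 1 | S _ => INR n + 1 end) with (INR (S n)). simpl pow. ring.
        + apply continuous_of_derive. auto_derive; auto. }
    enough (cos_moment (S n) 0 - cos_moment (S n) x <= c * cos_moment (S n) 0) by lra.
    apply (is_RInt_le _ _ 0 (PI / 2) _ _ ltac:(lra) H H').
    intros t Ht. rewrite Rmult_0_l, cos_0.
    assert (0 < cos t) by (apply cos_gt_0; lra).
    assert (Hc := t_cos_le_sin t ltac:(lra)).
    assert (H1 := one_minus_cos_le (x * t)).
    assert (0 <= cos t ^ n) by (apply pow_le; lra).
    apply Rle_trans with ((x * t) ^ 2 / 2 * cos t ^ S n).
    { replace (1 * cos t ^ S n - cos (x * t) * cos t ^ S n) with ((1 - cos (x * t)) * cos t ^ S n) by ring.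
      apply Rmult_le_compat_r; [apply pow_le; lra | auto]. }
    replace ((x * t) ^ 2 / 2 * cos t ^ S n) with (x ^ 2 / 2 * (t * (t * cos t) * cos t ^ n)) by (simpl; field).
    apply Rmult_le_compat_l; [ assert (0 <= x ^ 2) by apply pow2_ge_0; lra | ].
    apply Rmult_le_compat_r; auto. apply Rmult_le_compat_l; lra.
  - apply RInt_le; [lra | apply ex_RInt_cos_moment.. | ].
    intros t Ht. apply Rmult_le_compat_r; [apply pow_le; left; apply cos_gt_0; lra |].
    rewrite Rmult_0_l, cos_0. apply COS_bound.
Qed.

Lemma cos_moment_ratio_lim x :
  is_lim_seq (fun n => cos_moment (2 * n) x / cos_moment (2 * n) 0) 1.
Proof.
  apply is_lim_seq_incr_1.
  apply is_lim_seq_le_le with (fun n => 1 - x ^ 2 / 2 * / INR (S n)) (fun _ => 1).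
  - intros n. replace (2 * S n)%nat with (S (2 * n + 1)) by lia.
    destruct (cos_moment_bounds (2 * n + 1) x) as [H1 H2].
    assert (HI := cos_moment_0_pos (S (2 * n + 1))).
    split.
    + apply Rle_div_r; auto. eapply Rle_trans; [ | exact H1].
      apply Rmult_le_compat_r; [lra | ].
      assert (0 <= x ^ 2) by apply pow2_ge_0.
      assert (0 < INR (S n)) by (apply lt_0_INR; lia).
      assert (INR (S n) <= INR (S (2 * n + 1))) by (apply le_INR; lia).
      unfold Rdiv. rewrite Rinv_mult, Rmult_assoc.
      assert (/ INR (S (2 * n + 1)) <= / INR (S n)) by (apply Rinv_le_contravar; auto).
      nra.
    + apply Rle_div_l; auto. lra.
  - replace (Finite 1) with (Finite (1 - x ^ 2 / 2 * 0)) by (f_equal; ring).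
    apply is_lim_seq_minus'; [apply is_lim_seq_const | ].
    apply (is_lim_seq_scal_l (fun n => / INR (S n)) (x ^ 2 / 2) 0).
    apply (is_lim_seq_incr_1 (fun n => / INR n)).
    apply (is_lim_seq_inv _ p_infty); [apply is_lim_seq_INR | discriminate].
  - apply is_lim_seq_const.
Qed.

Lemma cos_moment_0 x : x <> 0 -> cos_moment 0 x = sin (x * (PI / 2)) / x.
Proof.
  intros Hx. apply is_RInt_unique.
  apply is_RInt_ext_R with (fun t => cos (x * t)); [intros; simpl; ring | ].
  replace (sin (x * (PI / 2)) / x) with (sin (x * (PI / 2)) / x - sin (x * 0) / x)
    by (rewrite Rmult_0_r, sin_0; field; auto).
  apply (is_RInt_of_derive (fun t => sin (x * t) / x)); intros t.
  - auto_derive; auto. field; auto.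
  - apply continuous_of_derive. auto_derive; auto.
Qed.

Lemma cos_moment_0_0 : cos_moment 0 0 = PI / 2.
Proof.
  apply is_RInt_unique.
  apply is_RInt_ext_R with (fun _ => 1); [intros; rewrite Rmult_0_l, cos_0; simpl; ring | ].
  replace (PI / 2) with (scal (PI / 2 - 0) 1) at 2 by (unfold scal; simpl; unfold mult; simpl; lra).
  apply (is_RInt_const (V := R_NormedModule)).
Qed.

(** Euler's product for the sine: the ratio of the 2n-th moments at 2z and at 0
    starts at sin (PI z) / (PI z), tends to 1, and by [cos_moment_step]
    consecutive ratios differ by the factor 1 - z^2 / (n+1)^2. *)
Lemma is_series_ln_sine_product z : 0 < z < 1 ->
  is_series (fun k => ln (1 - (z / INR (S k)) ^ 2)) (ln (sin (PI * z) / (PI * z))).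
Proof.
  intros Hz. assert (HP := PI_RGT_0).
  set (rho := fun n => cos_moment (2 * n) (2 * z) / cos_moment (2 * n) 0).
  assert (Hf : forall k, 0 < 1 - (z / INR (S k)) ^ 2).
  { intros k. assert (1 <= INR (S k)) by (apply (le_INR 1); lia).
    assert (0 < z / INR (S k) < 1). { split; [apply Rdiv_lt_0_compat; lra | apply Rlt_div_l; lra]. }
    nra. }
  assert (Hrho : forall n, rho n = (1 - (z / INR (S n)) ^ 2) * rho (S n)).
  { intros n. unfold rho. replace (2 * S n)%nat with (2 * n + 2)%nat by lia.
    assert (P1 := cos_moment_0_pos (2 * n)). assert (P2 := cos_moment_0_pos (2 * n + 2)).
    assert (E1 := cos_moment_step (2 * n) (2 * z)). assert (E2 := cos_moment_step (2 * n) 0).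
    assert (0 < INR (S n)) by (apply lt_0_INR; lia).
    assert (Q : 0 < INR (2 * n + 1)) by (apply lt_0_INR; lia).
    replace (INR (2 * n + 2)) with (2 * INR (S n)) in E1, E2
      by (replace (2 * n + 2)%nat with (2 * S n)%nat by lia; rewrite mult_INR; simpl; ring).
    assert (E3 : cos_moment (2 * n) 0 = 2 * INR (S n) / INR (2 * n + 1) * cos_moment (2 * n + 2) 0).
    { apply Rmult_eq_reg_l with (2 * INR (S n) * INR (2 * n + 1)); [ | nra].
      rewrite <- E2. field. lra. }
    assert (E4 : cos_moment (2 * n) (2 * z) =
       ((2 * INR (S n)) ^ 2 - (2 * z) ^ 2) / (2 * INR (S n) * INR (2 * n + 1)) * cos_moment (2 * n + 2) (2 * z)).
    { apply Rmult_eq_reg_l with (2 * INR (S n) * INR (2 * n + 1)); [ | nra].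
      rewrite <- E1. field. lra. }
    rewrite E3, E4. field. repeat split; lra. }
  assert (H0 : rho 0%nat = sin (PI * z) / (PI * z)).
  { unfold rho. simpl Nat.mul. rewrite cos_moment_0 by lra. rewrite cos_moment_0_0.
    replace (2 * z * (PI / 2)) with (PI * z) by field. field. lra. }
  assert (Hs : 0 < sin (PI * z)) by (apply sin_gt_0; nra).
  assert (Hpos : forall n, 0 < rho n).
  { induction n.
    - rewrite H0. apply Rdiv_lt_0_compat; nra.
    - specialize (Hrho n). specialize (Hf n). nra. }
  assert (Hsum : forall n, @eq R (sum_n (fun k => ln (1 - (z / INR (S k)) ^ 2)) n) (ln (rho 0%nat) - ln (rho (S n)))).
  { induction n.
    - rewrite sum_O, (Hrho 0%nat), ln_mult; auto. ring.
    - rewrite sum_n_S, IHn, (Hrho (S n)), ln_mult; auto. ring. }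
  rewrite <- H0. apply is_series_of_lim.
  apply (is_lim_seq_ext (fun n => ln (rho 0%nat) - ln (rho (S n)))).
  { intros n; symmetry; apply Hsum. }
  assert (HL : is_lim_seq (fun n => ln (rho (S n))) (ln 1)).
  { apply (is_lim_seq_continuous ln (fun n => rho (S n)) 1).
    - apply continuity_pt_of_derive. auto_derive; lra.
    - apply -> (is_lim_seq_incr_1 rho 1). exact (cos_moment_ratio_lim (2 * z)). }
  replace (Finite (ln (rho 0%nat))) with (Finite (ln (rho 0%nat) - ln 1)) by (rewrite ln_1; f_equal; ring).
  exact (is_lim_seq_minus' _ _ _ _ (is_lim_seq_const _) HL).
Qed.

(** * The Euler integral *)

(** Newton-Leibniz for improper integrals, with the derivative given as a
    function rather than through [Derive]. *)
Lemma is_RInt_gen_antiderivative (Fa Fb : (R -> Prop) -> Prop) (FFa : Filter Fa) (FFb : Filter Fb)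
    (f df : R -> R) (la lb : R) :
  filter_prod Fa Fb (fun ab => forall x, Rmin (fst ab) (snd ab) <= x <= Rmax (fst ab) (snd ab) ->
     is_derive f x (df x) /\ continuous df x) ->
  filterlim f Fa (locally la) -> filterlim f Fb (locally lb) ->
  is_RInt_gen df Fa Fb (lb - la).
Proof.
  intros HD Ha Hb P HP.
  assert (HL : filterlim (fun ab : R * R => f (snd ab) - f (fst ab)) (filter_prod Fa Fb) (locally (lb - la))).
  { eapply (filterlim_comp_2 (F := filter_prod Fa Fb) (G := locally lb) (H := locally (- la))
       (fun ab : R * R => f (snd ab)) (fun ab : R * R => - f (fst ab)) Rplus).
    - apply (filterlim_comp _ _ _ snd f _ Fb); [apply filterlim_snd | exact Hb].
    - apply (filterlim_comp _ _ _ (fun ab : R * R => f (fst ab)) Ropp _ (locally la)).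
      + apply (filterlim_comp _ _ _ fst f _ Fa); [apply filterlim_fst | exact Ha].
      + apply (filterlim_opp la).
    - apply (filterlim_plus lb (- la)). }
  specialize (HL P HP). unfold filtermap in HL.
  unfold filtermapi. generalize (filter_and _ _ HD HL). apply filter_imp.
  intros [a b] [H1 H2]. simpl in *. exists (f b - f a). split; auto.
  apply (is_RInt_derive (V := R_CompleteNormedModule) f df); intros x Hx; apply H1; auto.
Qed.

Notation is_improper f l := (is_RInt_gen (V := R_NormedModule) f (at_right 0) (Rbar_locally p_infty) l).

Lemma filter_prod_half_line (P : R * R -> Prop) :
  (forall a b, 0 < a -> a <= b -> P (a, b)) -> filter_prod (at_right 0) (Rbar_locally p_infty) P.
Proof.
  intros H. exists (fun a => 0 < a < 1) (fun b => 1 < b).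
  - exists (mkposreal 1 Rlt_0_1). intros y Hy H0.
    unfold ball in Hy; simpl in Hy; unfold AbsRing_ball, abs, minus, plus, opp in Hy; simpl in Hy.
    apply Rabs_lt_between in Hy. lra.
  - exists 1; auto.
  - intros a b Ha Hb. apply H; lra.
Qed.

(** [RInt_gen_norm] applied to 0 * f and g - f yields 0 <= lg - lf. *)
Lemma is_improper_le (f g : R -> R) (lf lg : R) :
  (forall t, 0 < t -> f t <= g t) -> is_improper f lf -> is_improper g lg -> lf <= lg.
Proof.
  intros H Hf Hg.
  assert (H1 := is_RInt_gen_minus g f lg lf Hg Hf).
  assert (H0 := is_RInt_gen_scal f 0 lf Hf).
  assert (H2 : norm (scal 0 lf) <= minus lg lf).
  { apply (RInt_gen_norm (V := R_CompleteNormedModule) (Fa := at_right 0) (Fb := Rbar_locally p_infty)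
      (fun y => scal 0 (f y)) (fun y => minus (g y) (f y))); [ | | exact H0 | exact H1].
    - apply filter_prod_half_line. intros a b _ Hab. exact Hab.
    - apply filter_prod_half_line. intros a b Ha _ x Hx. simpl in Hx. specialize (H x ltac:(lra)).
      unfold norm, scal, minus, plus, opp, mult; simpl; unfold abs, mult; simpl.
      rewrite Rmult_0_l, Rabs_R0. lra. }
  unfold norm, scal, minus, plus, opp, mult in H2; simpl in H2; unfold abs, mult in H2; simpl in H2.
  rewrite Rmult_0_l, Rabs_R0 in H2. lra.
Qed.

Lemma is_improper_ext (f g : R -> R) (l : R) :
  (forall t, 0 < t -> f t = g t) -> is_improper f l -> is_improper g l.
Proof.
  intros H. apply is_RInt_gen_ext. apply filter_prod_half_line.
  intros a b Ha Hb x Hx. simpl in Hx. rewrite Rmin_left in Hx by auto. apply H; lra.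
Qed.

(** The integrals over compact subintervals increase with the interval, so they
    converge to their least upper bound. *)
Lemma ex_improper_nonneg (f : R -> R) (M : R) :
  (forall t, 0 < t -> continuous f t) -> (forall t, 0 < t -> 0 <= f t) ->
  (forall a b, 0 < a -> a <= b -> RInt f a b <= M) ->
  exists l : R, is_improper f l.
Proof.
  intros Hc Hp HM.
  assert (Hex : forall a b, 0 < a -> a <= b -> ex_RInt f a b).
  { intros a b Ha Hab. apply (ex_RInt_continuous (V := R_CompleteNormedModule)).
    intros x Hx. rewrite Rmin_left in Hx by auto. apply Hc; lra. }
  assert (Hmono : forall a b a' b', 0 < a' -> a' <= a -> a <= b -> b <= b' -> RInt f a b <= RInt f a' b').
  { intros a b a' b' H1 H2 H3 H4.
    rewrite <- (RInt_Chasles f a' a b') by (apply Hex; lra).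
    rewrite <- (RInt_Chasles f a b b') by (apply Hex; lra).
    assert (0 <= RInt f a' a). { apply RInt_ge_0; auto. intros; apply Hp; lra. }
    assert (0 <= RInt f b b'). { apply RInt_ge_0; auto. apply Hex; lra. intros; apply Hp; lra. }
    unfold plus; simpl; lra. }
  destruct (completeness (fun y => exists a b, 0 < a /\ a <= b /\ y = RInt f a b)) as [l [Hub Hlub]].
  - exists M. intros y (a & b & Ha & Hab & ->). auto.
  - exists (RInt f 1 1), 1, 1. repeat split; lra.
  - exists l. intros P [eps HP].
    assert (exists a b, 0 < a /\ a <= b /\ l - eps < RInt f a b) as (a0 & b0 & Ha0 & Hab0 & H0).
    { destruct (Classical_Prop.classic (exists a b, 0 < a /\ a <= b /\ l - eps < RInt f a b)) as [H | H]; auto.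
      exfalso. assert (l <= l - eps); [ | destruct eps; simpl in *; lra].
      apply Hlub. intros y (a & b & Ha & Hab & ->). apply Rnot_lt_le. intros Hl. apply H. exists a, b; auto. }
    unfold filtermapi. exists (fun a => 0 < a <= a0) (fun b => b0 < b).
    + exists (mkposreal a0 Ha0). intros y Hy Hy0.
      unfold ball in Hy; simpl in Hy; unfold AbsRing_ball, abs, minus, plus, opp in Hy; simpl in Hy.
      apply Rabs_lt_between in Hy. lra.
    + exists b0; auto.
    + intros a b Ha Hb. exists (RInt f a b). simpl. split.
      * apply (RInt_correct (V := R_CompleteNormedModule)). apply Hex; lra.
      * apply HP. unfold ball; simpl; unfold AbsRing_ball, abs, minus, plus, opp; simpl.
        apply Rabs_lt_between.
        assert (RInt f a b <= l). { apply Hub. exists a, b. repeat split; lra. }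
        assert (RInt f a0 b0 <= RInt f a b) by (apply Hmono; lra).
        destruct eps; simpl in *; lra.
Qed.

Definition Euler_integrand (x t : R) : R := Rpower t (x - 1) * exp (- t).

Lemma is_derive_Rpower_exp x t : 0 < t ->
  is_derive (fun t => Rpower t x * exp (- t)) t (x * Euler_integrand x t - Euler_integrand (x + 1) t).
Proof.
  intros Ht. unfold Euler_integrand, Rpower. auto_derive; auto.
  replace ((x + 1 - 1) * ln t) with (x * ln t) by ring.
  replace ((x - 1) * ln t) with (x * ln t - ln t) by ring.
  replace (exp (x * ln t - ln t)) with (exp (x * ln t) / t); [field; lra | ].
  unfold Rminus. rewrite exp_plus, (exp_Ropp (ln t)), exp_ln by auto. reflexivity.
Qed.

Lemma continuous_Euler_integrand x t : 0 < t -> continuous (Euler_integrand x) t.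
Proof.
  intros Ht. apply continuous_of_derive. unfold Euler_integrand, Rpower. auto_derive; auto.
Qed.

Lemma exp_neg_mult_le t : 0 <= t -> (1 + t) * exp (- t) <= 1.
Proof.
  intros Ht. rewrite exp_Ropp. apply Rle_div_l; [apply exp_pos | ].
  rewrite Rmult_1_l. destruct (Req_dec t 0) as [-> | Hn]; [rewrite exp_0; lra | ].
  left. apply exp_ineq1. lra.
Qed.

(** Bernoulli's inequality: with w = 1 + x (t - 1), add ln y <= y - 1 at
    y = t / w with weight x and at y = 1 / w with weight 1 - x. *)
Lemma Rpower_le_linear x t : 0 < t -> 0 <= x <= 1 -> Rpower t x <= 1 + x * (t - 1).
Proof.
  intros Ht Hx. set (w := 1 + x * (t - 1)).
  assert (Hw : 0 < w) by (unfold w; nra).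
  assert (Hln : forall u, 0 < u -> ln u <= u - 1).
  { intros u Hu. generalize (exp_ineq1_le (ln u)). rewrite exp_ln by auto. lra. }
  assert (H1 := Hln (t / w) (Rdiv_lt_0_compat _ _ Ht Hw)).
  assert (H2 := Hln (1 / w) (Rdiv_lt_0_compat _ _ Rlt_0_1 Hw)).
  rewrite ln_div in H1, H2 by lra. rewrite ln_1 in H2.
  unfold Rpower. rewrite <- (exp_ln w) by auto.
  assert (x * ln t <= ln w).
  { assert (x * (ln t - ln w) <= x * (t / w - 1)) by (apply Rmult_le_compat_l; lra).
    assert ((1 - x) * (0 - ln w) <= (1 - x) * (1 / w - 1)) by (apply Rmult_le_compat_l; lra).
    assert (x * (t / w - 1) + (1 - x) * (1 / w - 1) = 0) by (unfold w in *; field; lra).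
    lra. }
  destruct H as [H | ->]; [left; apply exp_increasing; auto | right; auto].
Qed.

Lemma Rpower_le_1_plus x t : 0 < t -> 0 <= x <= 1 -> Rpower t x <= 1 + t.
Proof.
  intros Ht Hx. apply Rle_trans with (1 := Rpower_le_linear x t Ht Hx). nra.
Qed.

(** Apply [Rpower_le_linear] to the exponent 1 - x and invert: with
    s = (1 - x) (t - 1), t^x = t / t^(1-x) >= t / (1 + s) >= t (1 - s). *)
Lemma Rpower_ge_quadratic x t : 0 < t -> 0 <= x <= 1 -> t + (x - 1) * (t ^ 2 - t) <= Rpower t x.
Proof.
  intros Ht Hx.
  assert (H := Rpower_le_linear (1 - x) t Ht ltac:(lra)).
  set (s := (1 - x) * (t - 1)) in *.
  assert (Hp : 0 < Rpower t (1 - x)) by apply exp_pos.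
  assert (E : Rpower t x * Rpower t (1 - x) = t).
  { rewrite <- Rpower_plus. replace (x + (1 - x)) with 1 by ring. apply Rpower_1; auto. }
  apply Rmult_le_reg_r with (Rpower t (1 - x)); auto. rewrite E.
  replace (t + (x - 1) * (t ^ 2 - t)) with (t * (1 - s)) by (unfold s; ring).
  destruct (Rle_lt_dec 0 (1 - s)).
  - apply Rle_trans with (t * (1 - s) * (1 + s)).
    + apply Rmult_le_compat_l; nra.
    + replace (t * (1 - s) * (1 + s)) with (t - t * s ^ 2) by ring. nra.
  - assert (t * (1 - s) < 0) by nra. nra.
Qed.

(** The integrand is dominated by the derivative of the bounded function
    (t^x e^(-t) - (2 + t) e^(-t)) / x, because t^x <= 1 + t; this handles both
    end points at once. *)
Lemma ex_Euler_integral_small x : 0 < x <= 1 -> exists l : R, is_improper (Euler_integrand x) l.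
Proof.
  intros Hx. apply ex_improper_nonneg with (3 / x).
  - apply continuous_Euler_integrand.
  - intros t Ht. unfold Euler_integrand, Rpower. left. apply Rmult_lt_0_compat; apply exp_pos.
  - intros a b Ha Hab.
    (* h = H' splits as the Euler integrand plus the nonnegative quantity
       ((1 + t) e^(-t) - t^x e^(-t)) / x. *)
    set (H := fun t => (Rpower t x * exp (- t) - (2 + t) * exp (- t)) / x).
    set (h := fun t => (x * Euler_integrand x t - Euler_integrand (x + 1) t + (1 + t) * exp (- t)) / x).
    assert (Hh : is_RInt h a b (H b - H a)).
    { apply (is_RInt_derive (V := R_CompleteNormedModule) H h); intros t Ht; rewrite Rmin_left in Ht by auto.
      - unfold H, h.
        apply (is_derive_ext (fun t => / x * (Rpower t x * exp (- t) - (2 + t) * exp (- t)))).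
        { intros u. real_eq. field. lra. }
        replace ((x * Euler_integrand x t - Euler_integrand (x + 1) t + (1 + t) * exp (- t)) / x)
          with (/ x * (x * Euler_integrand x t - Euler_integrand (x + 1) t - (- ((1 + t) * exp (- t))))) by (field; lra).
        apply is_derive_scal. apply (is_derive_minus (K := R_AbsRing) (V := R_NormedModule)).
        + apply is_derive_Rpower_exp; lra.
        + auto_derive; auto. ring.
      - apply continuous_of_derive. unfold h, Euler_integrand, Rpower. auto_derive. repeat split; lra. }
    apply Rle_trans with (H b - H a).
    + rewrite <- (is_RInt_unique (V := R_CompleteNormedModule) h a b _ Hh). apply RInt_le; auto.
      * apply (ex_RInt_continuous (V := R_CompleteNormedModule)).
        intros t Ht; rewrite Rmin_left in Ht by auto. apply continuous_Euler_integrand; lra.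
      * exists (H b - H a); auto.
      * intros t Ht. unfold h.
        assert (Rpower t x <= 1 + t) by (apply Rpower_le_1_plus; lra).
        assert (Euler_integrand (x + 1) t <= (1 + t) * exp (- t)).
        { unfold Euler_integrand. replace (x + 1 - 1) with x by ring.
          apply Rmult_le_compat_r; [left; apply exp_pos | auto]. }
        apply le_div_of_mul_le; lra.
    + unfold H. apply Rle_div_r; [lra | ].
      replace (((Rpower b x * exp (- b) - (2 + b) * exp (- b)) / x -
        (Rpower a x * exp (- a) - (2 + a) * exp (- a)) / x) * x) with
       (Rpower b x * exp (- b) - (2 + b) * exp (- b)  -
        (Rpower a x * exp (- a) - (2 + a) * exp (- a))) by (field; lra).
      assert (Rpower b x <= 1 + b) by (apply Rpower_le_1_plus; lra).
      assert (0 < exp (- b)) by apply exp_pos. assert (0 < exp (- a)) by apply exp_pos.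
      assert (0 < Rpower a x) by apply exp_pos.
      assert (HE := exp_neg_mult_le a ltac:(lra)).
      assert (exp (- a) <= 1) by nra.
      assert ((1 + b - Rpower b x) * exp (- b) >= 0) by nra.
      assert (0 < Rpower a x * exp (- a)) by nra.
      nra.
Qed.

Lemma Rpower_exp_lim_0 x : 0 < x -> filterlim (fun t => Rpower t x * exp (- t)) (at_right 0) (locally 0).
Proof.
  intros Hx. unfold Rpower.
  apply (filterlim_ext (fun t => exp (x * ln t + - t))); [intros t; apply exp_plus | ].
  apply (filterlim_comp _ _ _ (fun t => x * ln t + - t) exp _ (Rbar_locally m_infty)); [ | apply is_lim_exp_m].
  apply (filterlim_comp_2 (F := at_right 0) (G := Rbar_locally m_infty) (H := locally (-0)) (fun t => x * ln t) (fun t => - t) Rplus).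
  - apply (filterlim_comp _ _ _ ln (fun u => x * u) _ (Rbar_locally m_infty)); [apply is_lim_ln_0 | ].
    assert (Z := filterlim_Rbar_mult_l x m_infty).
    replace (Rbar_mult x m_infty) with m_infty in Z; [exact Z | ].
    simpl. destruct (Rle_dec 0 x) as [h | h]; [ | lra]. destruct (Rle_lt_or_eq_dec 0 x h); [auto | lra].
  - apply (filterlim_filter_le_1 (F := locally 0)). { intros P [e He]. exists e. auto. }
    apply (filterlim_opp 0).
  - apply (filterlim_Rbar_plus m_infty (-0) m_infty). reflexivity.
Qed.

Lemma Rpower_exp_lim_p x : filterlim (fun t => Rpower t x * exp (- t)) (Rbar_locally p_infty) (locally 0).
Proof.
  unfold Rpower.
  apply (filterlim_ext_loc (fun t => exp (t * (x * (ln t / t) - 1)))).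
  { exists 0. intros t Ht. rewrite <- exp_plus. f_equal. field. lra. }
  apply (filterlim_comp _ _ _ (fun t => t * (x * (ln t / t) - 1)) exp _ (Rbar_locally m_infty)); [ | apply is_lim_exp_m].
  change (is_lim (fun t => t * (x * (ln t / t) - 1)) p_infty m_infty).
  replace m_infty with (Rbar_mult p_infty (x * 0 - 1)).
  2:{ simpl. destruct (Rle_dec 0 (x * 0 - 1)) as [h | h]; [exfalso; lra | auto]. }
  apply is_lim_mult.
  - apply is_lim_id.
  - apply (is_lim_minus' _ _ p_infty (x * 0) 1).
    + apply (is_lim_scal_l (fun t => ln t / t) x p_infty 0). apply is_lim_div_ln_p.
    + apply is_lim_const.
  - simpl. lra.
Qed.

(** Integration by parts: t^x e^(-t) vanishes at 0 and at infinity. *)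
Lemma Euler_integral_succ x l : 0 < x ->
  is_improper (Euler_integrand x) l -> is_improper (Euler_integrand (x + 1)) (x * l).
Proof.
  intros Hx Hl.
  assert (HD : is_improper (fun t => x * Euler_integrand x t - Euler_integrand (x + 1) t) (0 - 0)).
  { apply is_RInt_gen_antiderivative with (fun t => Rpower t x * exp (- t)).
    - apply at_right_proper_filter.
    - apply Rbar_locally_filter.
    - apply filter_prod_half_line. intros a b Ha Hab t Ht. simpl in Ht. rewrite Rmin_left in Ht by auto.
      split; [apply is_derive_Rpower_exp; lra | ].
      apply continuous_of_derive. unfold Euler_integrand, Rpower. auto_derive. repeat split; lra.
    - apply Rpower_exp_lim_0; auto.
    - apply Rpower_exp_lim_p. }
  assert (HS := is_RInt_gen_scal _ x l Hl).
  assert (HM := is_RInt_gen_minus _ _ _ _ HS HD).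
  replace (x * l) with (minus (scal x l) (0 - 0)).
  2:{ unfold minus, plus, opp, scal, mult; simpl; unfold mult; simpl; ring. }
  revert HM. apply is_improper_ext.
  intros t Ht. unfold minus, plus, opp, scal, mult; simpl; unfold mult; simpl; ring.
Qed.

Lemma is_improper_unique f l1 l2 : is_improper f l1 -> is_improper f l2 -> l1 = l2.
Proof.
  intros H1 H2.
  apply Rle_antisym; [ apply (is_improper_le f f) | apply (is_improper_le f f) ]; auto; intros; lra.
Qed.

Lemma is_improper_Gamma x : 0 < x <= 1 -> is_improper (Euler_integrand x) (Gamma x).
Proof.
  intros Hx. destruct (ex_Euler_integral_small x Hx) as [l Hl].
  unfold Gamma. apply (RInt_gen_correct (V := R_CompleteNormedModule) (Euler_integrand x)).
  exists l; auto.
Qed.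

Fixpoint rising (x : R) (n : nat) : R :=
  match n with O => 1 | S k => rising x k * (x + INR k) end.

Lemma Euler_integral_add x n : 0 < x <= 1 ->
  is_improper (Euler_integrand (x + INR n)) (Gamma x * rising x n).
Proof.
  intros Hx. induction n.
  - simpl. rewrite Rplus_0_r, Rmult_1_r. apply is_improper_Gamma; auto.
  - rewrite S_INR, <- Rplus_assoc. simpl rising.
    replace (Gamma x * (rising x n * (x + INR n))) with ((x + INR n) * (Gamma x * rising x n)) by ring.
    apply Euler_integral_succ; auto. generalize (pos_INR n); lra.
Qed.

Lemma Gamma_1 : Gamma 1 = 1.
Proof.
  apply (is_improper_unique (Euler_integrand 1)); [apply is_improper_Gamma; lra | ].
  replace 1 with (-0 - -1) at 2 by ring.
  apply (is_improper_ext (fun t => exp (- t))).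
  { intros t Ht. unfold Euler_integrand. replace (1 - 1) with 0 by ring. rewrite Rpower_O; auto. ring. }
  apply is_RInt_gen_antiderivative with (fun t => - exp (- t)).
  - apply at_right_proper_filter.
  - apply Rbar_locally_filter.
  - apply filter_prod_half_line. intros a b Ha Hab t Ht.
    split; [auto_derive; auto; ring | apply continuous_of_derive; auto_derive; auto].
  - apply (filterlim_filter_le_1 (F := locally 0)). { intros P [e He]. exists e. auto. }
    replace (-1) with (- exp (- 0)) by (rewrite Ropp_0, exp_0; ring).
    apply (continuous_of_derive (fun t => - exp (- t))). auto_derive; auto.
  - apply (filterlim_comp _ _ _ (fun t => exp (- t)) Ropp _ (locally 0)); [ | apply (filterlim_opp 0)].
    apply (filterlim_comp _ _ _ Ropp exp _ (Rbar_locally m_infty)); [ | apply is_lim_exp_m].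
    apply (filterlim_Rbar_opp p_infty).
Qed.

Lemma rising_1 n : rising 1 n = INR (fact n).
Proof.
  induction n; [reflexivity | ]. simpl rising. rewrite IHn, fact_simpl, mult_INR, S_INR. ring.
Qed.

Lemma Euler_integral_nat n : is_improper (Euler_integrand (INR n + 1)) (INR (fact n)).
Proof.
  assert (H := Euler_integral_add 1 n ltac:(lra)).
  rewrite Gamma_1, rising_1, Rmult_1_l, (Rplus_comm 1) in H. exact H.
Qed.

(** * The Gauss product and the logarithm of Gamma *)

Lemma Euler_integrand_succ y t : 0 < t -> Euler_integrand (y + 1) t = t * Euler_integrand y t.
Proof.
  intros Ht. unfold Euler_integrand. replace (y + 1 - 1) with (1 + (y - 1)) by ring.
  rewrite Rpower_plus, Rpower_1 by auto. ring.
Qed.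

Lemma Euler_integrand_scaled x n t : 0 < t ->
  Euler_integrand (x + INR (S (S n))) t
  = Rpower (INR (S n)) x * Rpower (t / INR (S n)) x * Euler_integrand (INR (S n) + 1) t.
Proof.
  intros Ht. assert (Hn : 0 < INR (S n)) by (apply lt_0_INR; lia).
  rewrite Rpower_mult_distr by (auto using Rdiv_lt_0_compat).
  replace (INR (S n) * (t / INR (S n))) with t by (field; lra).
  unfold Euler_integrand. rewrite (S_INR (S n)).
  replace (x + (INR (S n) + 1) - 1) with (x + (INR (S n) + 1 - 1)) by ring.
  rewrite Rpower_plus. ring.
Qed.

Lemma is_improper_comb (f g : R -> R) (a b lf lg : R) :
  is_improper f lf -> is_improper g lg -> is_improper (fun t => a * f t + b * g t) (a * lf + b * lg).
Proof.
  intros Hf Hg.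
  exact (is_RInt_gen_plus _ _ _ _ (is_RInt_gen_scal _ a _ Hf) (is_RInt_gen_scal _ b _ Hg)).
Qed.

Lemma Euler_integral_nat_succ n : is_improper (Euler_integrand (INR n + 1 + 1)) (INR (fact n) * (INR n + 1)).
Proof.
  replace (INR (fact n) * (INR n + 1)) with (INR (fact (S n))) by (rewrite fact_simpl, mult_INR, S_INR; ring).
  rewrite <- S_INR. apply Euler_integral_nat.
Qed.

Lemma Euler_integral_nat_succ2 n :
  is_improper (Euler_integrand (INR n + 1 + 1 + 1)) (INR (fact n) * (INR n + 1) * (INR n + 2)).
Proof.
  replace (INR (fact n) * (INR n + 1) * (INR n + 2)) with (INR (fact (S n)) * (INR (S n) + 1))
    by (rewrite fact_simpl, mult_INR, S_INR; ring).
  rewrite <- S_INR. apply Euler_integral_nat_succ.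
Qed.

(** Gauss's product formula says that this tends to 1; the index is shifted so
    that INR (S n) is positive. *)
Definition Gauss_ratio (x : R) (n : nat) : R :=
  Gamma x * rising x (S (S n)) / (Rpower (INR (S n)) x * INR (fact (S n))).

(** The numerator is Gamma (x + N + 1) with N = n + 1, that is the integral of
    N^x (t/N)^x t^N e^(-t).  Bounding (t/N)^x by polynomials in t/N leaves Euler
    integrals at integers, which are factorials. *)
Lemma Gauss_ratio_bounds x n : 0 < x <= 1 ->
  let v := / INR (S n) in
  (1 + v) * (2 - x + (x - 1) * (1 + 2 * v)) <= Gauss_ratio x n <= 1 + x * v.
Proof.
  intros Hx v. assert (Hn : 0 < INR (S n)) by (apply lt_0_INR; lia).
  assert (HP : 0 < Rpower (INR (S n)) x) by apply exp_pos.
  assert (HF := INR_fact_lt_0 (S n)).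
  assert (HE : forall y t, 0 <= Euler_integrand y t).
  { intros y t. left. apply Rmult_lt_0_compat; apply exp_pos. }
  assert (I0 := Euler_integral_add x (S (S n)) Hx).
  assert (I1 := Euler_integral_nat (S n)).
  assert (I2 := Euler_integral_nat_succ (S n)).
  assert (I3 := Euler_integral_nat_succ2 (S n)).
  assert (J1 := is_improper_comb _ _ (Rpower (INR (S n)) x * (1 - x)) (Rpower (INR (S n)) x * x * v) _ _ I1 I2).
  assert (J2 := is_improper_comb _ _ (Rpower (INR (S n)) x * (2 - x) * v) (Rpower (INR (S n)) x * (x - 1) * v ^ 2) _ _ I2 I3).
  unfold Gauss_ratio. set (N := INR (S n)) in *.
  split.
  - apply le_div_of_mul_le; [apply Rmult_lt_0_compat; auto | ].
    refine (Rle_trans _ _ _ _ (is_improper_le _ _ _ _ _ J2 I0)).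
    + right. unfold v. field. lra.
    + intros t Ht. rewrite Euler_integrand_scaled by auto. fold N.
      rewrite (Euler_integrand_succ (N + 1 + 1)), (Euler_integrand_succ (N + 1)) by auto.
      assert (B := Rpower_ge_quadratic x (t / N) (Rdiv_lt_0_compat _ _ Ht Hn) ltac:(lra)).
      replace (Rpower N x * (2 - x) * v * (t * Euler_integrand (N + 1) t) +
        Rpower N x * (x - 1) * v ^ 2 * (t * (t * Euler_integrand (N + 1) t)))
       with (Rpower N x * (t / N + (x - 1) * ((t / N) ^ 2 - t / N)) * Euler_integrand (N + 1) t)
        by (unfold v; field; lra).
      apply Rmult_le_compat_r; [apply HE | ]. apply Rmult_le_compat_l; lra.
  - apply div_le_of_le_mul; [apply Rmult_lt_0_compat; auto | ].
    refine (Rle_trans _ _ _ (is_improper_le _ _ _ _ _ I0 J1) _).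
    + intros t Ht. rewrite Euler_integrand_scaled by auto. fold N.
      rewrite (Euler_integrand_succ (N + 1)) by auto.
      assert (B := Rpower_le_linear x (t / N) (Rdiv_lt_0_compat _ _ Ht Hn) ltac:(lra)).
      replace (Rpower N x * (1 - x) * Euler_integrand (N + 1) t +
        Rpower N x * x * v * (t * Euler_integrand (N + 1) t))
       with (Rpower N x * (1 + x * (t / N - 1)) * Euler_integrand (N + 1) t)
        by (unfold v; field; lra).
      apply Rmult_le_compat_r; [apply HE | ]. apply Rmult_le_compat_l; lra.
    + right. unfold v. field. lra.
Qed.

Lemma is_lim_seq_inv_S : is_lim_seq (fun n => / INR (S n)) 0.
Proof.
  apply (is_lim_seq_incr_1 (fun n => / INR n)).
  apply (is_lim_seq_inv _ p_infty); [apply is_lim_seq_INR | discriminate].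
Qed.

Lemma is_lim_seq_of_continuous (f : R -> R) (u : nat -> R) (l : R) :
  ex_derive f l -> is_lim_seq u l -> is_lim_seq (fun n => f (u n)) (f l).
Proof.
  intros Hf Hu. apply is_lim_seq_continuous; auto. apply continuity_pt_of_derive; auto.
Qed.

Lemma Gauss_ratio_lim x : 0 < x <= 1 -> is_lim_seq (Gauss_ratio x) 1.
Proof.
  intros Hx.
  apply is_lim_seq_le_le with (fun n => (fun v => (1 + v) * (2 - x + (x - 1) * (1 + 2 * v))) (/ INR (S n)))
     (fun n => (fun v => 1 + x * v) (/ INR (S n))).
  - intros n. apply Gauss_ratio_bounds; auto.
  - replace (Finite 1) with (Finite ((fun v => (1 + v) * (2 - x + (x - 1) * (1 + 2 * v))) 0)) by (f_equal; ring).
    apply (is_lim_seq_of_continuous (fun v => (1 + v) * (2 - x + (x - 1) * (1 + 2 * v)))); [auto_derive; auto | apply is_lim_seq_inv_S].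
  - replace (Finite 1) with (Finite ((fun v => 1 + x * v) 0)) by (f_equal; ring).
    apply (is_lim_seq_of_continuous (fun v => 1 + x * v)); [auto_derive; auto | apply is_lim_seq_inv_S].
Qed.

Lemma rising_pos x n : 0 < x -> 0 < rising x n.
Proof.
  intros Hx. induction n; simpl; [lra | ]. apply Rmult_lt_0_compat; auto. generalize (pos_INR n); lra.
Qed.

(** If Gamma x <= 0, then no Gauss ratio is positive and they cannot tend to 1. *)
Lemma Gamma_pos x : 0 < x <= 1 -> 0 < Gamma x.
Proof.
  intros Hx. assert (HL := Gauss_ratio_lim x Hx).
  destruct (Rlt_le_dec 0 (Gamma x)) as [H | H]; auto. exfalso.
  assert (Rbar_le 1 0); [ | simpl in *; lra].
  apply (is_lim_seq_le (Gauss_ratio x) (fun _ => 0) 1 0); auto; [ | apply is_lim_seq_const].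
  intros n. unfold Gauss_ratio. apply div_le_of_le_mul.
  - apply Rmult_lt_0_compat; [apply exp_pos | apply INR_fact_lt_0].
  - generalize (rising_pos x (S (S n)) ltac:(lra)). nra.
Qed.

Lemma ln_rising x n : 0 < x ->
  ln (rising x (S (S n)) / INR (fact (S n))) = ln x + sum_n (fun k => ln (1 + x / INR (S k))) n.
Proof.
  intros Hx.
  assert (step : forall n, ln (rising x (S (S n)) / INR (fact (S n))) =
     ln (rising x (S n) / INR (fact n)) + ln (1 + x / INR (S n))).
  { intros k. assert (0 < INR (S k)) by (apply lt_0_INR; lia).
    assert (HF := INR_fact_lt_0 k).
    rewrite <- ln_mult.
    - f_equal. rewrite fact_simpl, mult_INR. change (rising x (S (S k))) with (rising x (S k) * (x + INR (S k))). field. lra.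
    - apply Rdiv_lt_0_compat; auto using rising_pos.
    - assert (0 < x / INR (S k)) by (apply Rdiv_lt_0_compat; auto). lra. }
  induction n.
  - rewrite step, sum_O. f_equal. f_equal. simpl. field.
  - rewrite step, sum_n_S, IHn. ring.
Qed.

Lemma harmonic_S n : harmonic (S n) = sum_n (fun k => / INR (S k)) n.
Proof. unfold harmonic, sum_n. symmetry. apply (sum_n_m_S (fun i => / INR i)). Qed.

(** The sequence decreases and is bounded below by 0; the definition of the
    constant as a [Lim_seq] carries no convergence by itself. *)
Lemma is_lim_seq_EulerMascheroni : is_lim_seq (fun n => harmonic (S n) - ln (INR (S n))) EulerMascheroni.
Proof.
  set (u := fun n => harmonic (S n) - ln (INR (S n))).
  assert (Hp : forall n, 0 < INR (S n)) by (intros; apply lt_0_INR; lia).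
  assert (Hln : forall y, 0 < y -> ln y <= y - 1).
  { intros y Hy. generalize (exp_ineq1_le (ln y)). rewrite exp_ln by auto. lra. }
  assert (HS : forall n, harmonic (S (S n)) = harmonic (S n) + / INR (S (S n))).
  { intros n. rewrite !harmonic_S. apply sum_n_S. }
  assert (Hu : ex_finite_lim_seq u).
  { apply ex_finite_lim_seq_decr with 0.
    - intros n. unfold u. rewrite HS.
      assert (H := Hln (INR (S n) / INR (S (S n))) (Rdiv_lt_0_compat _ _ (Hp _) (Hp _))).
      rewrite ln_div in H by apply Hp.
      replace (INR (S n) / INR (S (S n)) - 1) with (- / INR (S (S n))) in H; [lra | ].
      rewrite (S_INR (S n)). field. generalize (Hp n); lra.
    - assert (HH : forall n, ln (INR (S (S n))) <= harmonic (S n)).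
      { induction n.
        - rewrite harmonic_S, sum_O. simpl. replace (/ 1) with (1 + 1 - 1) by field. apply Hln; lra.
        - rewrite HS.
          assert (H := Hln (INR (S (S (S n))) / INR (S (S n))) (Rdiv_lt_0_compat _ _ (Hp _) (Hp _))).
          rewrite ln_div in H by apply Hp.
          replace (INR (S (S (S n))) / INR (S (S n)) - 1) with (/ INR (S (S n))) in H; [lra | ].
          rewrite (S_INR (S (S n))). field. generalize (Hp (S n)); lra. }
      intros n. unfold u. specialize (HH n).
      assert (ln (INR (S n)) <= ln (INR (S (S n)))); [ | lra].
      left. apply ln_increasing; [apply Hp | ]. rewrite (S_INR (S n)). lra. }
  unfold EulerMascheroni.
  rewrite <- (Lim_seq_incr_1 (fun n => harmonic n - ln (INR n))).
  destruct Hu as [l Hl]. replace (Lim_seq (fun n => harmonic (S n) - ln (INR (S n)))) with (Finite l); [exact Hl | ].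
  symmetry. apply is_lim_seq_unique. exact Hl.
Qed.

(** Weierstrass's form of Gamma: take logarithms in the Gauss ratio and trade
    ln (n+1) for the harmonic numbers. *)
Lemma is_series_logGamma x : 0 < x <= 1 ->
  is_series (fun k => ln (1 + x / INR (S k)) - x / INR (S k))
    (- EulerMascheroni * x - logGamma x - ln x).
Proof.
  intros Hx. apply is_series_of_lim.
  assert (HG := Gamma_pos x Hx).
  apply is_lim_seq_ext with
    (fun n => ln (Gauss_ratio x n) - (logGamma x + ln x) - x * (harmonic (S n) - ln (INR (S n)))).
  { intros n. unfold Gauss_ratio, logGamma.
    assert (Hr := rising_pos x (S (S n)) ltac:(lra)).
    assert (HF := INR_fact_lt_0 (S n)).
    replace (Gamma x * rising x (S (S n)) / (Rpower (INR (S n)) x * INR (fact (S n))))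
      with (Gamma x * (rising x (S (S n)) / INR (fact (S n))) / Rpower (INR (S n)) x)
      by (field; split; [lra | apply Rgt_not_eq, exp_pos]).
    rewrite ln_div; [ | apply Rmult_lt_0_compat; auto using Rdiv_lt_0_compat | apply exp_pos].
    rewrite ln_mult by auto using Rdiv_lt_0_compat.
    rewrite ln_rising by lra. unfold Rpower. rewrite ln_exp, harmonic_S.
    assert (E : forall n, @eq R (sum_n (fun k => ln (1 + x / INR (S k)) - x / INR (S k)) n)
       (sum_n (fun k => ln (1 + x / INR (S k))) n - x * sum_n (fun k => / INR (S k)) n)).
    { clear. induction n; [rewrite !sum_O; reflexivity | ]. rewrite !sum_n_S, IHn. unfold Rdiv. ring. }
    rewrite E. real_eq. ring. }
  replace (Finite (- EulerMascheroni * x - logGamma x - ln x))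
    with (Finite (ln 1 - (logGamma x + ln x) - x * EulerMascheroni)) by (rewrite ln_1; f_equal; ring).
  apply is_lim_seq_minus'.
  - apply is_lim_seq_minus'; [ | apply is_lim_seq_const].
    apply (is_lim_seq_of_continuous ln); [auto_derive; lra | apply Gauss_ratio_lim; auto].
  - apply (is_lim_seq_scal_l _ x EulerMascheroni), is_lim_seq_EulerMascheroni.
Qed.

(** * Clausen functions *)

Lemma INR_S_pos n : 0 < INR (S n).
Proof. apply lt_0_INR; lia. Qed.

Lemma ex_series_inv_square : ex_series (fun k => / INR (S k) ^ 2).
Proof.
  apply (ex_series_le (V := R_CompleteNormedModule) _ (fun k => 2 * (/ INR (S k) - / INR (S (S k))))).
  - intros k. unfold norm; simpl norm; unfold abs; simpl abs.
    assert (H := INR_S_pos k). rewrite (S_INR (S k)). set (a := INR (S k)) in *.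
    assert (1 <= a) by (apply (le_INR 1); lia).
    rewrite Rabs_right by (apply Rle_ge; left; apply Rinv_0_lt_compat, pow_lt; auto).
    replace (2 * (/ a - / (a + 1))) with (/ a ^ 2 * (2 * a / (a + 1))) by (field; lra).
    rewrite <- (Rmult_1_r (/ a ^ 2)) at 1. apply Rmult_le_compat_l.
    + left; apply Rinv_0_lt_compat, pow_lt; auto.
    + apply le_div_of_mul_le; lra.
  - exists 2. apply is_series_of_lim.
    apply is_lim_seq_ext with (fun n => 2 - 2 * / INR (S (S n))).
    + induction n; [rewrite sum_O; simpl; field | ]. rewrite sum_n_S, <- IHn. ring.
    + replace (Finite 2) with (Finite (2 - 2 * 0)) by (f_equal; ring).
      apply is_lim_seq_minus'; [apply is_lim_seq_const | ].
      apply (is_lim_seq_scal_l _ 2 0). apply -> (is_lim_seq_incr_1 (fun n => / INR (S n))). apply is_lim_seq_inv_S.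
Qed.

(** The tail of the series is dominated by the tail of the majorant. *)
Lemma CVU_Weierstrass (u : nat -> R -> R) (f : R -> R) (M : nat -> R) c r :
  ex_series M -> (forall k x, Rabs (u k x) <= M k) ->
  (forall x, is_series (fun k => u k x) (f x)) ->
  CVU (fun n x => sum_n (fun k => u k x) n) f c r.
Proof.
  intros [S HS] HM Hu eps Heps.
  apply lim_of_is_series, is_lim_seq_spec in HS.
  destruct (HS (mkposreal eps Heps)) as [N HN]. simpl in HN.
  exists N. intros n y Hn _.
  assert (B : forall d, Rabs (sum_n (fun k => u k y) (d + n) - sum_n (fun k => u k y) n)
       <= sum_n M (d + n) - sum_n M n).
  { induction d.
    - simpl. replace (sum_n (fun k : nat => u k y) n - sum_n (fun k : nat => u k y) n) with 0 by ring.
      rewrite Rabs_R0. lra.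
    - simpl Nat.add. rewrite !sum_n_S.
      replace (sum_n (fun k : nat => u k y) (d + n) + u (Datatypes.S (d + n)) y - sum_n (fun k : nat => u k y) n)
        with ((sum_n (fun k : nat => u k y) (d + n) - sum_n (fun k : nat => u k y) n) + u (Datatypes.S (d + n)) y) by ring.
      apply Rle_trans with (1 := Rabs_triang _ _). specialize (HM (Datatypes.S (d + n)) y). lra. }
  apply Rle_lt_trans with (S - sum_n M n).
  - assert (L1 : is_lim_seq (fun d => Rabs (sum_n (fun k => u k y) (d + n) - sum_n (fun k => u k y) n))
        (Rabs (f y - sum_n (fun k => u k y) n))).
    { apply (is_lim_seq_abs _ (f y - sum_n (fun k => u k y) n)).
      apply is_lim_seq_minus'; [ | apply is_lim_seq_const].
      apply -> (is_lim_seq_incr_n (sum_n (fun k => u k y)) n). apply lim_of_is_series, Hu. }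
    assert (L2 : is_lim_seq (fun d => sum_n M (d + n) - sum_n M n) (S - sum_n M n)).
    { apply is_lim_seq_minus'; [ | apply is_lim_seq_const].
      apply -> (is_lim_seq_incr_n (sum_n M) n). apply is_lim_seq_spec. exact HS. }
    exact (is_lim_seq_le _ _ _ _ B L1 L2).
  - specialize (HN n Hn). apply Rabs_lt_between in HN. lra.
Qed.

Definition trig (n : nat) : R -> R := if Nat.even n then sin else cos.

Definition Clausen_term (n k : nat) (x : R) : R := trig n (INR (S k) * x) / INR (S k) ^ n.

Lemma Clausen_term_bound n k x : (2 <= n)%nat -> Rabs (Clausen_term n k x) <= / INR (S k) ^ 2.
Proof.
  intros Hn. assert (H := INR_S_pos k). unfold Clausen_term, Rdiv. rewrite Rabs_mult.
  assert (Hp : 0 < INR (S k) ^ n) by (apply pow_lt; auto).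
  rewrite (Rabs_right (/ _)) by (apply Rle_ge; left; apply Rinv_0_lt_compat; auto).
  assert (Rabs (trig n (INR (S k) * x)) <= 1).
  { unfold trig. apply Rabs_le. destruct (Nat.even n); [apply SIN_bound | apply COS_bound]. }
  assert (/ INR (S k) ^ n <= / INR (S k) ^ 2).
  { apply Rinv_le_contravar; [apply pow_lt; auto | ]. apply Rle_pow; auto. apply (le_INR 1); lia. }
  assert (0 < / INR (S k) ^ n) by (apply Rinv_0_lt_compat; auto).
  generalize (Rabs_pos (trig n (INR (S k) * x))). nra.
Qed.

Lemma is_series_Clausen n x : (2 <= n)%nat -> is_series (fun k => Clausen_term n k x) (Clausen n x).
Proof.
  intros Hn.
  assert (E : ex_series (fun k => Clausen_term n k x)).
  { apply (ex_series_le (V := R_CompleteNormedModule) _ (fun k => / INR (S k) ^ 2)); [ | apply ex_series_inv_square].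
    intros k. apply Clausen_term_bound; auto. }
  apply Series_correct in E. unfold Clausen, Clausen_term, trig in *.
  destruct (Nat.even n); exact E.
Qed.

Lemma is_derive_Clausen_term n k x :
  is_derive (Clausen_term (S n) k) x ((if Nat.even n then -1 else 1) * Clausen_term n k x).
Proof.
  unfold Clausen_term, trig. rewrite Nat.even_succ, <- Nat.negb_even.
  generalize (INR_S_pos k). generalize (INR (S k)). intros a Ha.
  destruct (Nat.even n); unfold negb.
  - apply (is_derive_ext (fun x => / a ^ S n * cos (a * x))).
    { intros t. real_eq. unfold Rdiv. ring. }
    auto_derive; auto. field. split; [apply pow_nonzero | ]; lra.
  - apply (is_derive_ext (fun x => / a ^ S n * sin (a * x))).
    { intros t. real_eq. unfold Rdiv. ring. }
    auto_derive; auto. field. split; [apply pow_nonzero | ]; lra.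
Qed.

Lemma continuous_Clausen n x : (2 <= n)%nat -> continuous (Clausen n) x.
Proof.
  intros Hn. apply continuity_pt_filterlim.
  apply (CVU_continuity (fun N x => sum_n (fun k => Clausen_term n k x) N) (Clausen n) x (mkposreal 1 Rlt_0_1)).
  - apply (CVU_Weierstrass (Clausen_term n) _ (fun k => / INR (S k) ^ 2)).
    + apply ex_series_inv_square.
    + intros; apply Clausen_term_bound; auto.
    + intros; apply is_series_Clausen; auto.
  - intros N y _. apply continuity_pt_of_derive.
    eexists. apply (is_derive_sum_n (Clausen_term n) N y (fun k => Derive (Clausen_term n k) y)).
    intros k _. apply Derive_correct. destruct n; [lia | ]. eexists. apply is_derive_Clausen_term.
  - unfold Boule. simpl. rewrite Rminus_diag, Rabs_R0. lra.
Qed.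

(** Term-by-term differentiation near x; the function g is the sum of the series
    of order n.  At order 1 the uniform convergence is only local. *)
Lemma is_derive_Clausen_of_CVU n (g : R -> R) x (r : posreal) : (1 <= n)%nat ->
  CVU (fun N x => sum_n (fun k => Clausen_term n k x) N) g x r ->
  (forall y, Boule x r y -> continuity_pt g y) ->
  is_derive (Clausen (S n)) x ((if Nat.even n then -1 else 1) * g x).
Proof.
  intros Hn HU Hc. apply is_derive_Reals.
  set (s := if Nat.even n then -1 else 1).
  apply (derivable_pt_lim_CVU (fun N x => sum_n (fun k => Clausen_term (S n) k x) N)
    (fun N x => s * sum_n (fun k => Clausen_term n k x) N) (Clausen (S n)) (fun x => s * g x) x x r).
  - unfold Boule. rewrite Rminus_diag, Rabs_R0. apply cond_pos.
  - intros y N _. apply is_derive_Reals.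
    replace (s * sum_n (fun k : nat => Clausen_term n k y) N) with (sum_n (fun k : nat => s * Clausen_term n k y) N).
    + apply (is_derive_sum_n (Clausen_term (S n)) N y (fun k => s * Clausen_term n k y)).
      intros k _. apply is_derive_Clausen_term.
    + apply (sum_n_mult_l (K := R_Ring)).
  - intros y _. assert (H := lim_of_is_series _ _ (is_series_Clausen (S n) y ltac:(lia))).
    apply is_lim_seq_Reals in H. exact H.
  - intros eps Heps. destruct (HU eps Heps) as [N HN]. exists N. intros n' y Hn' Hy.
    specialize (HN n' y Hn' Hy). rewrite <- Rmult_minus_distr_l, Rabs_mult.
    replace (Rabs s) with 1; [lra | ]. unfold s. destruct (Nat.even n); [rewrite Rabs_left | rewrite Rabs_right]; lra.
  - intros y Hy. apply (continuity_pt_scal g s y). auto.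
Qed.

Lemma is_derive_Clausen n x : (2 <= n)%nat ->
  is_derive (Clausen (S n)) x ((if Nat.even n then -1 else 1) * Clausen n x).
Proof.
  intros Hn. apply (is_derive_Clausen_of_CVU n (Clausen n) x (mkposreal 1 Rlt_0_1)); [lia | | ].
  - apply (CVU_Weierstrass (Clausen_term n) _ (fun k => / INR (S k) ^ 2)).
    + apply ex_series_inv_square.
    + intros; apply Clausen_term_bound; auto.
    + intros; apply is_series_Clausen; auto.
  - intros y _. apply continuity_pt_filterlim, continuous_Clausen; auto.
Qed.

Lemma cos_half_step a x : cos ((a - / 2) * x) - cos ((a + / 2) * x) = 2 * sin (a * x) * sin (x / 2).
Proof.
  replace ((a - / 2) * x) with (a * x - x / 2) by field.
  replace ((a + / 2) * x) with (a * x + x / 2) by field.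
  rewrite cos_minus, cos_plus. ring.
Qed.

(** The conjugate Dirichlet kernel, by telescoping [cos_half_step]. *)
Lemma sum_sin_multiples n x : sin (x / 2) <> 0 ->
  sum_n (fun k => sin (INR (S k) * x)) n
  = (cos (x / 2) - cos ((INR (S n) + / 2) * x)) / (2 * sin (x / 2)).
Proof.
  intros Hx. induction n.
  - rewrite sum_O. apply Rmult_eq_reg_r with (2 * sin (x / 2)); [ | lra].
    replace (cos (x / 2)) with (cos ((INR 1 - / 2) * x)) by (f_equal; simpl; field).
    rewrite cos_half_step. field. auto.
  - rewrite sum_n_S, IHn.
    replace (INR (S n) + / 2) with (INR (S (S n)) - / 2) by (rewrite (S_INR (S n)); field).
    assert (H := cos_half_step (INR (S (S n))) x).
    replace (cos ((INR (S (S n)) + / 2) * x)) with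
      (cos ((INR (S (S n)) - / 2) * x) - 2 * sin (INR (S (S n)) * x) * sin (x / 2)) by lra.
    real_eq. field. auto.
Qed.

Lemma cos_multiple_PI n : cos (INR n * PI) = (-1) ^ n.
Proof.
  induction n; [simpl; rewrite Rmult_0_l, cos_0; auto | ].
  rewrite S_INR, Rmult_plus_distr_r, Rmult_1_l, neg_cos, IHn. simpl. ring.
Qed.

(** On [0, 1] the function phi, ln (1 + x) minus its Taylor polynomial, has
    derivative (-x)^(n+1) / (1 + x), hence both phi and - phi are bounded by
    x^(n+2) / (n+2). *)
Lemma alternating_harmonic_bound n :
  Rabs (ln 2 + sum_n (fun k => cos (INR (S k) * PI) / INR (S k)) n) <= / INR (S (S n)).
Proof.
  set (phi := fun x => ln (1 + x) + sum_n (fun k => (- x) ^ S k / INR (S k)) n).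
  assert (Hphi : forall x, 0 <= x -> is_derive phi x ((- x) ^ S n / (1 + x))).
  { intros x Hx.
    assert (E : forall m, sum_n (fun k => - (- x) ^ k) m = ((- x) ^ S m - 1) / (1 + x)).
    { induction m; [rewrite sum_O; simpl; field; lra | ].
      rewrite sum_n_S, IHm. simpl. field. lra. }
    replace ((- x) ^ S n / (1 + x)) with (plus (/ (1 + x)) (sum_n (fun k => - (- x) ^ k) n))
     by (rewrite E; unfold plus; simpl; field; lra).
    apply (is_derive_plus (V := R_NormedModule)).
    - auto_derive; lra.
    - apply (is_derive_sum_n (fun k x => (- x) ^ S k / INR (S k)) n x (fun k => - (- x) ^ k)).
      intros k _. generalize (INR_S_pos k). intros Ha.
      apply (is_derive_ext (fun x => / INR (S k) * (- x) ^ S k)); [intros t; real_eq; field; lra | ].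
      replace (- (- x) ^ k) with (/ INR (S k) * (INR (S k) * -1 * (- x) ^ k)) by (field; lra).
      apply is_derive_scal. apply (is_derive_pow (fun x => - x) (S k) x (-1)). auto_derive; auto. }
  assert (Hp : forall s, s = 1 \/ s = -1 -> s * phi 1 <= / INR (S (S n))).
  { intros s Hs.
    assert (Hd : forall x, 0 <= x -> is_derive (fun x => s * phi x - / INR (S (S n)) * x ^ S (S n)) x
        (s * ((- x) ^ S n / (1 + x)) - x ^ S n)).
    { intros x Hx. apply (is_derive_minus (V := R_NormedModule)).
      - apply is_derive_scal. auto.
      - replace (x ^ S n) with (/ INR (S (S n)) * (INR (S (S n)) * 1 * x ^ S n))
          by (field; generalize (INR_S_pos (S n)); lra).
        apply is_derive_scal. apply (is_derive_pow (fun x => x) (S (S n)) x 1). auto_derive; auto. }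
    destruct (MVT_gen (fun x => s * phi x - / INR (S (S n)) * x ^ S (S n)) 0 1
      (fun x => s * ((- x) ^ S n / (1 + x)) - x ^ S n)) as [c [Hc E]].
    - intros x Hx. rewrite Rmin_left in Hx by lra. apply Hd; lra.
    - intros x Hx. rewrite Rmin_left in Hx by lra. apply continuity_pt_of_derive. eexists. apply Hd; lra.
    - rewrite Rmin_left, Rmax_right in Hc by lra.
      assert (phi 0 = 0).
      { unfold phi. rewrite Rplus_0_r, ln_1.
        assert (Z : forall m, sum_n (fun k : nat => (- 0) ^ S k / INR (S k)) m = 0).
        { induction m; [rewrite sum_O | rewrite sum_n_S, IHm];
            rewrite Ropp_0, pow_i by lia; real_eq; unfold Rdiv; ring. }
        rewrite Z. ring. }
      rewrite H, pow_i, pow1 in E by lia.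
      assert (s * ((- c) ^ S n / (1 + c)) - c ^ S n <= 0); [ | lra].
      assert (Ha : s * ((- c) ^ S n) <= c ^ S n).
      { apply Rle_trans with (1 := Rle_abs _). rewrite Rabs_mult, <- RPow_abs, Rabs_Ropp.
        rewrite (Rabs_right c) by lra.
        replace (Rabs s) with 1; [lra | ]. destruct Hs as [-> | ->]; [rewrite Rabs_right | rewrite Rabs_left]; lra. }
      assert (Hc' : 0 <= c ^ S n) by (apply pow_le; lra).
      replace (s * ((- c) ^ S n / (1 + c))) with (s * (- c) ^ S n / (1 + c)) by (field; lra).
      assert (s * (- c) ^ S n / (1 + c) <= c ^ S n); [ | lra].
      apply div_le_of_le_mul; nra. }
  assert (E : phi 1 = ln 2 + sum_n (fun k => cos (INR (S k) * PI) / INR (S k)) n).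
  { unfold phi. f_equal. apply sum_n_ext. intros k. rewrite cos_multiple_PI. reflexivity. }
  rewrite <- E. apply Rabs_le. generalize (Hp 1 (or_introl eq_refl)) (Hp (-1) (or_intror eq_refl)). lra.
Qed.

Lemma sin_half_lower d x : 0 < d -> d <= x <= 2 * PI - d -> sin (d / 2) <= sin (x / 2).
Proof.
  intros Hd Hx. assert (HP := PI_RGT_0).
  destruct (Rle_lt_dec x PI).
  - apply sin_incr_1; lra.
  - replace (x / 2) with (PI - (PI - x / 2)) by ring. rewrite sin_PI_x. apply sin_incr_1; lra.
Qed.

Lemma Rabs_div_le a b A B : 0 < B -> B <= b -> Rabs a <= A -> Rabs (a / b) <= A / B.
Proof.
  intros HB Hb Ha. unfold Rdiv. rewrite Rabs_mult, Rabs_inv, (Rabs_right b) by lra.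
  apply Rmult_le_compat; auto using Rabs_pos.
  - left; apply Rinv_0_lt_compat; lra.
  - apply Rinv_le_contravar; auto.
Qed.

(** The remainder ln (2 sin (y/2)) + sum_(k <= N) cos(ky) / k, with N = n + 1, has
    derivative cos((N + 1/2) y) / (2 sin (y/2)).  Subtracting the O(1/N) function
    W = sin((N + 1/2) y) / ((2N + 1) sin (y/2)) leaves the derivative dV, which is
    O(1/N) uniformly away from 0 and 2 PI.  At y = PI the remainder is that of the
    alternating harmonic series. *)
Lemma CVU_Clausen_1 x : 0 < x < 2 * PI ->
  exists r : posreal, (forall y, Boule x r y -> 0 < sin (y / 2)) /\
  CVU (fun N x => sum_n (fun k => Clausen_term 1 k x) N) (fun x => - ln (2 * sin (x / 2))) x r.
Proof.
  intros Hx. assert (HP := PI_RGT_0).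
  (* The ball of radius d around x and the point PI both lie in [d, 2 PI - d]. *)
  set (d := Rmin x (2 * PI - x) / 2).
  assert (Hd : 0 < d <= PI / 2 /\ d <= x / 2 /\ d <= (2 * PI - x) / 2).
  { unfold d. assert (A := Rmin_l x (2 * PI - x)). assert (B := Rmin_r x (2 * PI - x)).
    assert (0 < Rmin x (2 * PI - x)) by (apply Rmin_glb_lt; lra). lra. }
  assert (Hs : 0 < sin (d / 2)) by (apply sin_gt_0; lra).
  set (s := sin (d / 2)) in *.
  assert (HB : forall y, Boule x (mkposreal d (proj1 (proj1 Hd))) y -> d <= y <= 2 * PI - d).
  { intros y Hy. unfold Boule in Hy; simpl in Hy. apply Rabs_lt_between in Hy. lra. }
  assert (HS : forall y, d <= y <= 2 * PI - d -> s <= sin (y / 2)).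
  { intros y Hy. apply sin_half_lower; lra. }
  exists (mkposreal d (proj1 (proj1 Hd))). split.
  { intros y Hy. specialize (HS y (HB y Hy)). lra. }
  set (C := 1 + 1 + 1 / s + PI / s ^ 2).
  assert (key : forall n y, d <= y <= 2 * PI - d ->
    Rabs (- ln (2 * sin (y / 2)) - sum_n (fun k => Clausen_term 1 k y) n) <= C * / INR (S n)).
  { intros n y Hy.
    set (a := INR (S n) + / 2).
    assert (Ha : 0 < INR (S n) < a) by (unfold a; generalize (INR_S_pos n); lra).
    set (Rn := fun y => ln (2 * sin (y / 2)) + sum_n (fun k => Clausen_term 1 k y) n).
    set (W := fun y => sin (a * y) / (2 * a * sin (y / 2))).
    set (dV := fun y => sin (a * y) * cos (y / 2) / (4 * a * sin (y / 2) ^ 2)).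
    assert (HdV : forall y, d <= y <= 2 * PI - d -> is_derive (fun y => Rn y - W y) y (dV y)).
    { intros t Ht. specialize (HS t Ht).
      replace (dV t) with (cos (a * t) / (2 * sin (t / 2)) -
          (cos (a * t) / (2 * sin (t / 2)) - sin (a * t) * cos (t / 2) / (4 * a * sin (t / 2) ^ 2))).
      2:{ unfold dV. ring. }
      apply (is_derive_minus (V := R_NormedModule)).
      - replace (cos (a * t) / (2 * sin (t / 2))) with
         (plus (/ 2 * cos (t / 2) / sin (t / 2)) (sum_n (fun k => -1 * sin (INR (S k) * t)) n)).
        + apply (is_derive_plus (V := R_NormedModule)).
          * auto_derive; [lra | unfold Rdiv in *; field; lra].
          * apply (is_derive_sum_n (Clausen_term 1) n t (fun k => -1 * sin (INR (S k) * t))).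
            intros k _. replace (-1 * sin (INR (S k) * t)) with (-1 * Clausen_term 0 k t).
            -- apply (is_derive_Clausen_term 0).
            -- unfold Clausen_term, trig. change (Nat.even 0) with true. cbv iota. rewrite pow_O. field.
        + replace (sum_n (fun k => -1 * sin (INR (S k) * t)) n) with (-1 * sum_n (fun k => sin (INR (S k) * t)) n)
            by (symmetry; apply (sum_n_mult_l (K := R_Ring))).
          rewrite sum_sin_multiples by lra. fold a. unfold plus; simpl. field. lra.
      - unfold W. auto_derive.
        + repeat split; auto. nra.
        + unfold Rdiv in *. field. lra. }
    assert (HdVb : forall y, d <= y <= 2 * PI - d -> Rabs (dV y) <= 1 / (4 * INR (S n) * s ^ 2)).
    { intros t Ht. specialize (HS t Ht). unfold dV.
      assert (0 < s ^ 2) by (apply pow_lt; lra).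
      assert (s ^ 2 <= sin (t / 2) ^ 2) by (apply pow_incr; lra).
      apply Rabs_div_le; [nra | nra | ].
      rewrite Rabs_mult, <- (Rmult_1_l 1).
      apply Rmult_le_compat; try apply Rabs_pos; apply Rabs_le; [apply SIN_bound | apply COS_bound]. }
    assert (Hpi : Rabs (Rn PI) <= / INR (S n)).
    { unfold Rn. replace (2 * sin (PI / 2)) with 2 by (rewrite sin_PI2; ring).
      replace (sum_n (fun k => Clausen_term 1 k PI) n) with (sum_n (fun k => cos (INR (S k) * PI) / INR (S k)) n).
      - apply Rle_trans with (1 := alternating_harmonic_bound n).
        apply Rinv_le_contravar; [lra | ]. rewrite (S_INR (S n)). lra.
      - apply sum_n_ext. intros k. unfold Clausen_term, trig. simpl Nat.even. cbv iota. rewrite pow_1. reflexivity. }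
    assert (HW : forall t u, 0 < u -> u <= sin (t / 2) -> Rabs (W t) <= 1 / u * / INR (S n)).
    { intros t u Hu Ht. unfold W.
      replace (1 / u * / INR (S n)) with (1 / (u * INR (S n))) by (field; lra).
      apply Rabs_div_le; [nra | nra | apply Rabs_le, SIN_bound]. }
    assert (W1 := HW y s Hs (HS y Hy)).
    assert (W2 := HW PI 1 ltac:(lra) ltac:(rewrite sin_PI2; lra)).
    destruct (MVT_gen (fun y => Rn y - W y) PI y dV) as [c [Hc E]].
    { intros t Ht. apply HdV. revert Ht. unfold Rmin, Rmax. destruct (Rle_dec PI y); intros; lra. }
    { intros t Ht. apply continuity_pt_of_derive. eexists. apply HdV. revert Ht. unfold Rmin, Rmax. destruct (Rle_dec PI y); intros; lra. }
    assert (Hc' : d <= c <= 2 * PI - d). { revert Hc. unfold Rmin, Rmax. destruct (Rle_dec PI y); intros; lra. }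
    specialize (HdVb c Hc').
    assert (HE : Rabs (dV c * (y - PI)) <= PI / s ^ 2 * / INR (S n)).
    { rewrite Rabs_mult.
      assert (Rabs (y - PI) <= PI) by (apply Rabs_le; lra).
      assert (0 < s ^ 2) by (apply pow_lt; lra).
      apply Rle_trans with (1 / (4 * INR (S n) * s ^ 2) * PI).
      - apply Rmult_le_compat; auto; apply Rabs_pos.
      - assert (0 < / INR (S n)) by (apply Rinv_0_lt_compat; lra).
        assert (0 < / s ^ 2) by (apply Rinv_0_lt_compat; lra).
        replace (1 / (4 * INR (S n) * s ^ 2) * PI) with (/ 4 * (PI * (/ s ^ 2 * / INR (S n)))) by (field; lra).
        replace (PI / s ^ 2 * / INR (S n)) with (PI * (/ s ^ 2 * / INR (S n))) by (field; lra).
        assert (0 < PI * (/ s ^ 2 * / INR (S n))) by (apply Rmult_lt_0_compat; [ | apply Rmult_lt_0_compat]; lra). lra. }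
    rewrite <- Rabs_Ropp.
    replace (- (- ln (2 * sin (y / 2)) - sum_n (fun k => Clausen_term 1 k y) n))
      with (Rn PI + - W PI + W y + dV c * (y - PI)).
    2:{ rewrite <- E. unfold Rn. ring. }
    unfold C. rewrite !Rmult_plus_distr_r, Rmult_1_l.
    repeat (eapply Rle_trans; [apply Rabs_triang | ]; apply Rplus_le_compat); auto.
    rewrite Rabs_Ropp. lra. }
  intros eps Heps.
  assert (L : is_lim_seq (fun n => C * / INR (S n)) 0).
  { replace (Finite 0) with (Finite (C * 0)) by (f_equal; ring).
    apply (is_lim_seq_scal_l _ C 0), is_lim_seq_inv_S. }
  apply is_lim_seq_spec in L. destruct (L (mkposreal eps Heps)) as [N HN]. change (pos (mkposreal eps Heps)) with eps in HN.
  exists N. intros n y Hn Hy. specialize (HN n Hn). specialize (key n y (HB y Hy)).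
  apply Rabs_lt_between in HN. rewrite Rminus_0_r in HN.
  apply Rle_lt_trans with (1 := key). lra.
Qed.

Lemma is_derive_Clausen_2 x : 0 < x < 2 * PI -> is_derive (Clausen 2) x (- ln (2 * sin (x / 2))).
Proof.
  intros Hx. destruct (CVU_Clausen_1 x Hx) as (r & Hr & HU).
  replace (- ln (2 * sin (x / 2))) with ((if Nat.even 1 then -1 else 1) * - ln (2 * sin (x / 2))) by (simpl; ring).
  apply (is_derive_Clausen_of_CVU 1 (fun x => - ln (2 * sin (x / 2))) x r); auto.
  intros y Hy. specialize (Hr y Hy). apply continuity_pt_of_derive. auto_derive. lra.
Qed.

Lemma zeta_pow n : zeta (INR n) = Series (fun k => / INR (S k) ^ n).
Proof.
  unfold zeta. apply Series_ext. intros k. rewrite Rpower_pow; auto. apply INR_S_pos.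
Qed.

Lemma Clausen_even_0 n : Nat.even n = true -> Clausen n 0 = 0.
Proof.
  intros H. unfold Clausen. rewrite H.
  rewrite (Series_ext _ (fun k => 0)); [ | intros k; rewrite Rmult_0_r, sin_0; unfold Rdiv; ring].
  apply is_series_unique, is_series_of_lim.
  apply is_lim_seq_ext with (fun _ => 0); [ | apply is_lim_seq_const].
  intros m. symmetry. apply (sum_n_m_const_zero (G := R_AbelianMonoid)).
Qed.

Lemma Clausen_odd_0 n : Nat.even n = false -> Clausen n 0 = zeta (INR n).
Proof.
  intros H. unfold Clausen. rewrite H, zeta_pow. apply Series_ext.
  intros k. rewrite Rmult_0_r, cos_0. unfold Rdiv; ring.
Qed.

(** * Power series with even gaps and odd zeta values *)

Definition bounded_seq (a : nat -> R) : Prop := exists M, forall j, Rabs (a j) <= M.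

(** The series of a_j z^(2j+n). *)
Definition gap_series (a : nat -> R) (n : nat) (z : R) : R := z ^ n * PSeries a (z ^ 2).

Lemma CV_radius_bounded_seq a z : bounded_seq a -> Rabs z < 1 ->
  Rbar_lt (Rabs (z ^ 2)) (CV_radius a).
Proof.
  intros [M HM] Hz. apply Rbar_lt_le_trans with 1.
  - change (Rabs (z ^ 2) < 1). rewrite <- RPow_abs. generalize (Rabs_pos z). nra.
  - apply (proj1 (CV_radius_bounded a)). exists M. intros n. rewrite pow1, Rmult_1_r. auto.
Qed.

Lemma is_series_gap a n z : bounded_seq a -> Rabs z < 1 ->
  is_series (fun j => a j * z ^ (2 * j + n)) (gap_series a n z).
Proof.
  intros Ha Hz.
  assert (H := CV_radius_inside _ _ (CV_radius_bounded_seq a z Ha Hz)).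
  apply PSeries_correct, is_pseries_R in H.
  apply (is_series_scal_l (K := R_AbsRing) (V := R_NormedModule) (z ^ n)) in H.
  revert H. apply is_series_ext. intros j. change (z ^ n * (a j * (z ^ 2) ^ j) = a j * z ^ (2 * j + n)).
  rewrite pow_add, pow_mult. ring.
Qed.

(** Term-by-term differentiation, reduced to that of the power series in z^2. *)
Lemma is_derive_gap_series a n z : bounded_seq a -> Rabs z < 1 ->
  is_derive (gap_series a (S n)) z (gap_series (fun j => INR (2 * j + n + 1) * a j) n z).
Proof.
  intros Ha Hz. assert (HC := CV_radius_bounded_seq a z Ha Hz).
  set (x := z ^ 2) in *.
  assert (E : PSeries (fun j => INR (2 * j + n + 1) * a j) x
     = INR (n + 1) * PSeries a x + 2 * (x * PSeries (PS_derive a) x)).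
  { rewrite <- PSeries_incr_1, <- !PSeries_scal, <- PSeries_plus.
    - apply PSeries_ext. intros [ | j].
      + change (INR (2 * 0 + n + 1) * a 0%nat = INR (n + 1) * a 0%nat + 2 * 0).
        rewrite Rmult_0_r, Rplus_0_r. reflexivity.
      + change (INR (2 * S j + n + 1) * a (S j) = INR (n + 1) * a (S j) + 2 * (INR (S j) * a (S j))).
        replace (2 * S j + n + 1)%nat with (n + 1 + 2 * S j)%nat by lia.
        rewrite plus_INR, mult_INR. change (INR 2) with 2. ring.
    - apply ex_pseries_scal; [apply Rmult_comm | ]. apply CV_radius_inside; auto.
    - apply ex_pseries_scal; [apply Rmult_comm | ]. apply ex_pseries_incr_1, CV_radius_inside.
      rewrite CV_radius_derive; auto. }
  unfold gap_series. fold x. rewrite E.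
  assert (HD := is_derive_PSeries a x HC).
  replace (z ^ n * (INR (n + 1) * PSeries a x + 2 * (x * PSeries (PS_derive a) x)))
    with (INR (S n) * 1 * z ^ n * PSeries a x + z ^ S n * (INR 2 * 1 * z ^ 1 * PSeries (PS_derive a) x)).
  2:{ rewrite (Nat.add_comm n 1). unfold x. simpl Nat.add. simpl (INR 2). simpl pow. ring. }
  apply (is_derive_mult (fun z => z ^ S n) (fun z => PSeries a (z ^ 2))).
  - apply (is_derive_pow (fun x => x) (S n) z 1). auto_derive; auto.
  - apply (is_derive_comp (V := R_NormedModule) (PSeries a) (fun z => z ^ 2)); [exact HD | ].
    apply (is_derive_pow (fun x => x) 2 z 1). auto_derive; auto.
  - intros; apply Rmult_comm.
Qed.

Lemma gap_series_0 a n : gap_series a (S n) 0 = 0.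
Proof. unfold gap_series. rewrite pow_i by lia. ring. Qed.

Lemma is_series_le (a b : nat -> R) la lb :
  (forall k, a k <= b k) -> is_series a la -> is_series b lb -> la <= lb.
Proof.
  intros H Ha Hb. apply (is_lim_seq_le (sum_n a) (sum_n b) la lb); auto.
  intros n. unfold sum_n. apply sum_n_m_le. auto.
Qed.

Lemma is_series_partial_le (a : nat -> R) l n :
  (forall k, 0 <= a k) -> is_series a l -> sum_n a n <= l.
Proof.
  intros H Ha. apply (is_lim_seq_incr_compare (sum_n a)); auto.
  intros k. rewrite sum_n_S. specialize (H (S k)). lra.
Qed.

Lemma is_series_sum_n (a : nat -> nat -> R) (c : nat -> R) N :
  (forall j, is_series (a j) (c j)) -> is_series (fun k => sum_n (fun j => a j k) N) (sum_n c N).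
Proof.
  intros H. induction N.
  - rewrite sum_O. apply (is_series_ext (a 0%nat)); auto. intros k. rewrite sum_O. auto.
  - rewrite sum_n_S. apply (is_series_ext (fun k => sum_n (fun j => a j k) N + a (S N) k)).
    + intros k. rewrite sum_n_S. auto.
    + apply (is_series_plus (V := R_NormedModule)); auto.
Qed.

(** Interchange of summation for nonnegative double sequences: the partial sums
    of each order of summation are bounded by the total of the other. *)
Lemma is_series_Tonelli (a : nat -> nat -> R) (b c : nat -> R) (l : R) :
  (forall j k, 0 <= a j k) -> (forall k, is_series (fun j => a j k) (b k)) ->
  (forall j, is_series (fun k => a j k) (c j)) -> is_series b l -> is_series c l.
Proof.
  intros Hp Hb Hc Hl.
  assert (Hc0 : forall j, 0 <= c j).
  { intros j. apply Rle_trans with (sum_n (a j) 0); [rewrite sum_O; auto | ].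
    apply is_series_partial_le; auto. }
  assert (HN : forall N, sum_n c N <= l).
  { intros N. refine (is_series_le _ _ _ _ _ (is_series_sum_n a c N Hc) Hl).
    intros k. apply (is_series_partial_le (fun j => a j k)); auto. }
  destruct (ex_finite_lim_seq_incr (sum_n c) l) as [L HL]; auto.
  { intros N. rewrite sum_n_S. specialize (Hc0 (S N)). lra. }
  replace l with L; [exact HL | ].
  apply Rle_antisym.
  - apply (is_lim_seq_le (sum_n c) (fun _ => l) L l); auto. apply is_lim_seq_const.
  - apply (is_lim_seq_le (sum_n b) (fun _ => L) l L); [ | exact Hl | apply is_lim_seq_const].
    intros K. refine (is_series_le _ _ _ _ _ (is_series_sum_n (fun k j => a j k) b K Hb) HL).
    intros j. apply (is_series_partial_le (a j)); auto.
Qed.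

Lemma bounded_seq_inv n : bounded_seq (fun j => / INR (2 * j + S n)).
Proof.
  exists 1. intros j. assert (1 <= INR (2 * j + S n)) by (apply (le_INR 1); lia).
  rewrite Rabs_right by (apply Rle_ge; left; apply Rinv_0_lt_compat; lra).
  rewrite <- Rinv_1. apply Rinv_le_contravar; lra.
Qed.

(** Both sides vanish at 0 and have the derivative t^2 / (1 - t^2). *)
Lemma is_series_artanh u : 0 <= u < 1 ->
  is_series (fun j => / INR (2 * j + 3) * u ^ (2 * j + 3)) (ln (1 + u) / 2 - ln (1 - u) / 2 - u).
Proof.
  intros Hu.
  replace (ln (1 + u) / 2 - ln (1 - u) / 2 - u) with (gap_series (fun j => / INR (2 * j + 3)) 3 u).
  { apply is_series_gap; [apply bounded_seq_inv | rewrite Rabs_right; lra]. }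
  set (D := fun u => gap_series (fun j => / INR (2 * j + 3)) 3 u - (ln (1 + u) / 2 - ln (1 - u) / 2 - u)).
  assert (HD : forall t, 0 <= t < 1 -> is_derive D t 0).
  { intros t Ht.
    assert (E : gap_series (fun j => INR (2 * j + 2 + 1) * / INR (2 * j + 3)) 2 t = t ^ 2 / (1 - t ^ 2)).
    { unfold gap_series, Rdiv. f_equal.
      apply is_pseries_unique, is_pseries_R.
      apply (is_series_ext (fun n => (t ^ 2) ^ n)).
      - intros n. replace (2 * n + 2 + 1)%nat with (2 * n + 3)%nat by lia. real_eq. field.
        apply not_0_INR. lia.
      - apply is_series_geom. rewrite Rabs_right; nra. }
    replace 0 with (t ^ 2 / (1 - t ^ 2) - (1 / (1 + t) / 2 - -1 / (1 - t) / 2 - 1)).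
    2:{ field. split; [lra | split; [lra | nra]]. }
    apply (is_derive_minus (V := R_NormedModule)).
    - rewrite <- E. apply (is_derive_gap_series _ 2); [apply bounded_seq_inv | rewrite Rabs_right; lra].
    - auto_derive; [lra | field; lra]. }
  destruct (MVT_gen D 0 u (fun _ => 0)) as [c [Hc E]].
  - intros t Ht. rewrite Rmin_left, Rmax_right in Ht by lra. apply HD; lra.
  - intros t Ht. rewrite Rmin_left, Rmax_right in Ht by lra.
    apply continuity_pt_of_derive. exists 0. apply HD; lra.
  - unfold D in E. rewrite gap_series_0, Rplus_0_r, !Rminus_0_r, !ln_1 in E. lra.
Qed.

Lemma is_series_zeta n : (2 <= n)%nat -> is_series (fun k => / INR (S k) ^ n) (zeta (INR n)).
Proof.
  intros Hn. rewrite zeta_pow. apply Series_correct.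
  apply (ex_series_le (V := R_CompleteNormedModule) _ (fun k => / INR (S k) ^ 2)); [ | apply ex_series_inv_square].
  intros k. unfold norm; simpl norm; unfold abs; simpl abs. assert (H := INR_S_pos k).
  rewrite Rabs_right by (apply Rle_ge; left; apply Rinv_0_lt_compat, pow_lt; auto).
  apply Rinv_le_contravar; [apply pow_lt; auto | ]. apply Rle_pow; auto. apply (le_INR 1); lia.
Qed.

Lemma zeta_bounds n : (2 <= n)%nat -> 0 <= zeta (INR n) <= zeta (INR 2).
Proof.
  intros Hn. assert (HS := is_series_zeta n Hn). assert (H2 := is_series_zeta 2 ltac:(lia)).
  assert (Hp : forall m k, 0 < / INR (S k) ^ m) by (intros; apply Rinv_0_lt_compat, pow_lt, INR_S_pos).
  split.
  - apply Rle_trans with (sum_n (fun k => / INR (S k) ^ n) 0).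
    + rewrite sum_O. left; auto.
    + apply is_series_partial_le; auto. intros; left; auto.
  - refine (is_series_le _ _ _ _ _ HS H2).
    intros k. apply Rinv_le_contravar; [apply pow_lt, INR_S_pos | ]. apply Rle_pow; auto. apply (le_INR 1); lia.
Qed.

(** Interchange the sums over the powers of z / k and over k: the inner sum is
    artanh (z/k) - z/k, which splits into the general terms of the series of
    log Gamma and of the sine product. *)
Lemma is_series_odd_zeta z : 0 < z < 1 ->
  is_series (fun j => zeta (INR (2 * j + 3)) / INR (2 * j + 3) * z ^ (2 * j + 3))
    (- EulerMascheroni * z - logGamma z - ln z - / 2 * ln (sin (PI * z) / (PI * z))).
Proof.
  intros Hz.
  assert (Hu : forall k, 0 < z / INR (S k) < 1).
  { intros k. assert (1 <= INR (S k)) by (apply (le_INR 1); lia).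
    split; [apply Rdiv_lt_0_compat; lra | apply Rlt_div_l; lra]. }
  apply is_series_Tonelli with
   (a := fun j k => / INR (2 * j + 3) * (z / INR (S k)) ^ (2 * j + 3))
   (b := fun k => ln (1 + z / INR (S k)) / 2 - ln (1 - z / INR (S k)) / 2 - z / INR (S k)).
  - intros j k. apply Rmult_le_pos.
    + left. apply Rinv_0_lt_compat, lt_0_INR. lia.
    + apply pow_le. left; apply Hu.
  - intros k. apply is_series_artanh. specialize (Hu k). lra.
  - intros j. assert (H := is_series_zeta (2 * j + 3) ltac:(lia)).
    apply (is_series_scal_l (K := R_AbsRing) (V := R_NormedModule) (/ INR (2 * j + 3) * z ^ (2 * j + 3))) in H.
    replace (zeta (INR (2 * j + 3)) / INR (2 * j + 3) * z ^ (2 * j + 3))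
      with (/ INR (2 * j + 3) * z ^ (2 * j + 3) * zeta (INR (2 * j + 3))) by (unfold Rdiv; ring).
    revert H. apply is_series_ext. intros k.
    change (/ INR (2 * j + 3) * z ^ (2 * j + 3) * / INR (S k) ^ (2 * j + 3)
      = / INR (2 * j + 3) * (z * / INR (S k)) ^ (2 * j + 3)).
    rewrite Rpow_mult_distr, pow_inv. ring.
  - assert (H1 := is_series_logGamma z ltac:(lra)).
    assert (H2 := is_series_ln_sine_product z Hz).
    apply (is_series_scal_l (K := R_AbsRing) (V := R_NormedModule) (/ 2)) in H2.
    assert (H := is_series_minus _ _ _ _ H1 H2). revert H. apply is_series_ext.
    intros k. specialize (Hu k). set (u := z / INR (S k)) in *.
    change (ln (1 + u) - u + - (/ 2 * ln (1 - u ^ 2)) = ln (1 + u) / 2 - ln (1 - u) / 2 - u).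
    replace (1 - u ^ 2) with ((1 + u) * (1 - u)) by ring. rewrite ln_mult by lra. field.
Qed.

(** * Behaviour at 0 and integration by parts along a chain of antiderivatives *)

Notation tends_at_0 f l := (filterlim f (at_right 0) (locally l%R)).

Lemma at_right_0_of_unit (P : R -> Prop) : (forall z, 0 < z < 1 -> P z) -> at_right 0 P.
Proof.
  intros H. exists (mkposreal 1 Rlt_0_1). intros y Hy H0. apply H.
  unfold ball in Hy; simpl in Hy; unfold AbsRing_ball, abs, minus, plus, opp in Hy; simpl in Hy.
  apply Rabs_lt_between in Hy. lra.
Qed.

Lemma tends_at_0_ext (f g : R -> R) l :
  (forall z, 0 < z < 1 -> f z = g z) -> tends_at_0 f l -> tends_at_0 g l.
Proof. intros H. apply filterlim_ext_loc, at_right_0_of_unit. exact H. Qed.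

Lemma tends_at_0_lin (f g : R -> R) a b lf lg :
  tends_at_0 f lf -> tends_at_0 g lg -> tends_at_0 (fun z => a * f z + b * g z) (a * lf + b * lg).
Proof.
  intros Hf Hg.
  apply (filterlim_comp_2 (G := locally (a * lf)) (H := locally (b * lg)) (fun z => a * f z) (fun z => b * g z) Rplus).
  - apply (filterlim_comp _ _ _ f (fun y => a * y) _ (locally lf)); auto. apply (filterlim_scal_r (K := R_AbsRing) (V := R_NormedModule) a lf).
  - apply (filterlim_comp _ _ _ g (fun y => b * y) _ (locally lg)); auto. apply (filterlim_scal_r (K := R_AbsRing) (V := R_NormedModule) b lg).
  - apply (filterlim_plus (V := R_NormedModule)).
Qed.

Lemma tends_at_0_mult (f g : R -> R) lf lg :
  tends_at_0 f lf -> tends_at_0 g lg -> tends_at_0 (fun z => f z * g z) (lf * lg).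
Proof.
  intros Hf Hg.
  apply (filterlim_comp_2 (G := locally lf) (H := locally lg) f g Rmult); auto.
  apply (filterlim_mult (K := R_AbsRing)).
Qed.

Lemma tends_at_0_of_continuous (f : R -> R) : continuous f 0 -> tends_at_0 f (f 0).
Proof.
  intros H. apply (filterlim_filter_le_1 (F := locally 0)); [ | exact H].
  intros P [e He]. exists e. auto.
Qed.

Lemma tends_at_0_of_derive (f : R -> R) : ex_derive f 0 -> tends_at_0 f (f 0).
Proof. intros H. apply tends_at_0_of_continuous, continuous_of_derive, H. Qed.

(** The difference is constant on (0, 1) and tends to 0. *)
Lemma antiderivative_unique (f g df : R -> R) :
  (forall z, 0 < z < 1 -> is_derive f z (df z)) ->
  (forall z, 0 < z < 1 -> is_derive g z (df z)) ->
  tends_at_0 f 0 -> tends_at_0 g 0 -> forall z, 0 < z < 1 -> f z = g z.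
Proof.
  intros Hf Hg Lf Lg z Hz.
  assert (HD : forall t, 0 < t < 1 -> is_derive (fun t => f t - g t) t 0).
  { intros t Ht. replace 0 with (df t - df t) by ring.
    apply (is_derive_minus (V := R_NormedModule)); auto. }
  assert (L : tends_at_0 (fun t => 1 * f t + -1 * g t) (1 * 0 + -1 * 0)) by (apply tends_at_0_lin; auto).
  assert (L' : tends_at_0 (fun _ : R => f z - g z) (1 * 0 + -1 * 0)).
  { revert L. apply tends_at_0_ext. intros t Ht.
    destruct (MVT_gen (fun t => f t - g t) t z (fun _ => 0)) as [c [_ E]].
    - intros x Hx. apply HD. revert Hx. unfold Rmin, Rmax. destruct (Rle_dec t z); intros; lra.
    - intros x Hx. apply continuity_pt_of_derive. exists 0. apply HD.
      revert Hx. unfold Rmin, Rmax. destruct (Rle_dec t z); intros; lra.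
    - lra. }
  assert (f z - g z = 1 * 0 + -1 * 0); [ | lra].
  exact (filterlim_locally_unique (V := R_NormedModule) (F := at_right 0) (fun _ => f z - g z) _ _ (filterlim_const _) L').
Qed.

Definition derivative_chain (f : nat -> R -> R) : Prop :=
  forall k z, 0 < z < 1 -> is_derive (f (S k)) z (f k z).

Lemma derivative_chain_lin f g a b : derivative_chain f -> derivative_chain g ->
  derivative_chain (fun k z => a * f k z + b * g k z).
Proof.
  intros Hf Hg k z Hz. apply (is_derive_plus (V := R_NormedModule)); apply is_derive_scal; auto.
Qed.

(** The antiderivative of z^p f_(m-1) obtained by repeated integration by parts,
    when f is a derivative chain. *)
Fixpoint by_parts (p : nat) (f : nat -> R -> R) (m : nat) (z : R) : R :=
  match p with
  | O => f m z
  | S q => z ^ p * f m z - INR p * by_parts q f (S m) z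
  end.

Lemma is_derive_by_parts p f m z : derivative_chain f -> 0 < z < 1 ->
  is_derive (by_parts p f (S m)) z (z ^ p * f m z).
Proof.
  intros Hf Hz. revert m. induction p; intros m.
  - simpl. rewrite Rmult_1_l. apply Hf; auto.
  - replace (z ^ S p * f m z) with
      (INR (S p) * 1 * z ^ p * f (S m) z + z ^ S p * f m z - INR (S p) * (z ^ p * f (S m) z)) by ring.
    apply (is_derive_minus (V := R_NormedModule) (fun z => z ^ S p * f (S m) z) (fun z => INR (S p) * by_parts p f (S (S m)) z)).
    + apply (is_derive_mult (fun z => z ^ S p) (f (S m))); [ | apply Hf; auto | intros; apply Rmult_comm].
      apply (is_derive_pow (fun x => x) (S p) z 1). auto_derive; auto.
    + apply is_derive_scal. apply IHp.
Qed.

(** At 0 only the term without a power of z survives. *)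
Lemma by_parts_at_0 p f m (l : nat -> R) : (forall k, (m <= k)%nat -> tends_at_0 (f k) (l k)) ->
  tends_at_0 (by_parts p f m) ((-1) ^ p * INR (fact p) * l (m + p)%nat).
Proof.
  revert m. induction p; intros m Hl.
  - rewrite Nat.add_0_r. simpl. rewrite !Rmult_1_l. apply Hl; auto.
  - assert (H1 : tends_at_0 (fun z => z ^ S p) (0 ^ S p)).
    { apply (tends_at_0_of_derive (fun z => z ^ S p)). auto_derive; auto. }
    assert (H2 := tends_at_0_lin _ _ 1 (- INR (S p)) _ _ (tends_at_0_mult _ _ _ _ H1 (Hl m (le_n m)))
       (IHp (S m) (fun k hk => Hl k ltac:(lia)))).
    replace ((-1) ^ S p * INR (fact (S p)) * l (m + S p)%nat) with
      (1 * (0 ^ S p * l m) + - INR (S p) * ((-1) ^ p * INR (fact p) * l (S m + p)%nat)).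
    + revert H2. apply tends_at_0_ext. intros z _.
      change (by_parts (S p) f m z) with (z ^ S p * f m z - INR (S p) * by_parts p f (S m) z). ring.
    + rewrite pow_i by lia. rewrite fact_simpl, mult_INR. replace (m + S p)%nat with (S m + p)%nat by lia.
      simpl pow. ring.
Qed.

Lemma sum_n_m_first (a : nat -> R) n : sum_n_m a 0 (S n) = a 0%nat + sum_n_m (fun k => a (S k)) 0 n.
Proof.
  rewrite sum_Sn_m by lia. rewrite (sum_n_m_S a 0 n). reflexivity.
Qed.

Lemma by_parts_eq_sum p f m z :
  by_parts p f m z = sum_n_m (fun k => (-1) ^ k * INR (fact p) / INR (fact (p - k)) * z ^ (p - k) * f (m + k)%nat z) 0 p.
Proof.
  revert m. induction p; intros m.
  - rewrite sum_n_n, Nat.add_0_r. simpl. field.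
  - rewrite sum_n_m_first.
    change (by_parts (S p) f m z) with (z ^ S p * f m z - INR (S p) * by_parts p f (S m) z). rewrite IHp.
    unfold Rminus. f_equal.
    + rewrite Nat.sub_0_r, Nat.add_0_r, pow_O. field. apply INR_fact_neq_0.
    + rewrite Ropp_mult_distr_l.
      rewrite <- (sum_n_m_mult_l (K := R_Ring)).
      apply sum_n_m_ext. intros k.
      change (S p - S k)%nat with (p - k)%nat. replace (m + S k)%nat with (S m + k)%nat by lia.
      rewrite fact_simpl, mult_INR.
      change (- INR (S p) * ((-1) ^ k * INR (fact p) / INR (fact (p - k)) * z ^ (p - k) * f (S m + k)%nat z) =
       (-1) ^ S k * (INR (S p) * INR (fact p)) / INR (fact (p - k)) * z ^ (p - k) * f (S m + k)%nat z).
      rewrite <- tech_pow_Rmult. field. apply INR_fact_neq_0.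
Qed.

(** The antiderivative in t of (z - t)^j / j! times g_0, by repeated integration
    by parts.  Every summand but the last vanishes at t = z. *)
Fixpoint Taylor_antiderivative (j : nat) (g : nat -> R -> R) (z t : R) : R :=
  match j with
  | O => g 1%nat t
  | S i => (z - t) ^ j / INR (fact j) * g 1%nat t + Taylor_antiderivative i (fun k => g (S k)) z t
  end.

Lemma Taylor_antiderivative_end j g z : Taylor_antiderivative j g z z = g (S j) z.
Proof.
  revert g. induction j; intros g; [reflexivity | ].
  simpl Taylor_antiderivative. rewrite Rminus_diag, IHj. simpl pow. unfold Rdiv. ring.
Qed.

Lemma is_derive_Taylor_antiderivative j g z t : derivative_chain g -> 0 < t < 1 ->
  is_derive (Taylor_antiderivative j g z) t ((z - t) ^ j / INR (fact j) * g 0%nat t).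
Proof.
  revert g. induction j; intros g Hg Ht.
  - simpl. replace (1 / 1 * g 0%nat t) with (g 0%nat t) by field. apply Hg; auto.
  - assert (Hp : is_derive (fun t => (z - t) ^ S j / INR (fact (S j))) t (- ((z - t) ^ j / INR (fact j)))).
    { apply (is_derive_ext (fun t => / INR (fact (S j)) * (z - t) ^ S j)); [intros; real_eq; unfold Rdiv; ring | ].
      replace (- ((z - t) ^ j / INR (fact j))) with (/ INR (fact (S j)) * (INR (S j) * (-1) * (z - t) ^ j)).
      - apply is_derive_scal. apply (is_derive_pow (fun t => z - t) (S j) t (-1)). auto_derive; auto; ring.
      - rewrite fact_simpl, mult_INR. field. split; [apply INR_fact_neq_0 | apply not_0_INR; lia]. }
    replace ((z - t) ^ S j / INR (fact (S j)) * g 0%nat t)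
     with ((- ((z - t) ^ j / INR (fact j)) * g 1%nat t + (z - t) ^ S j / INR (fact (S j)) * g 0%nat t)
        + (z - t) ^ j / INR (fact j) * g 1%nat t) by ring.
    apply (is_derive_plus (V := R_NormedModule) (fun t => (z - t) ^ S j / INR (fact (S j)) * g 1%nat t)
       (Taylor_antiderivative j (fun k => g (S k)) z)).
    + apply (is_derive_mult (fun t => (z - t) ^ S j / INR (fact (S j))) (g 1%nat)); auto. intros; apply Rmult_comm.
    + apply (IHj (fun k => g (S k))); auto. intros k u Hu. apply Hg; auto.
Qed.

Lemma Taylor_antiderivative_at_0 j g z : (forall k, tends_at_0 (g (S k)) 0) ->
  tends_at_0 (Taylor_antiderivative j g z) 0.
Proof.
  revert g. induction j; intros g Hg.
  - apply Hg.
  - assert (H1 : tends_at_0 (fun t => (z - t) ^ S j / INR (fact (S j))) ((z - 0) ^ S j / INR (fact (S j)))).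
    { apply (tends_at_0_of_derive (fun t => (z - t) ^ S j / INR (fact (S j)))). auto_derive; auto. }
    assert (H2 := tends_at_0_lin _ _ 1 1 _ _ (tends_at_0_mult _ _ _ _ H1 (Hg 0%nat))
       (IHj (fun k => g (S k)) (fun k => Hg (S k)))).
    replace 0 with (1 * ((z - 0) ^ S j / INR (fact (S j)) * 0) + 1 * 0) at 2 by ring.
    revert H2. apply tends_at_0_ext. intros t _.
    change (Taylor_antiderivative (S j) g z t) with
      ((z - t) ^ S j / INR (fact (S j)) * g 1%nat t + Taylor_antiderivative j (fun k => g (S k)) z t).
    ring.
Qed.

(** Cauchy's formula for repeated integration, with an improper lower end point.
    Only the values of h inside (0, 1) matter, so h may be a function that is
    known there through the chain alone. *)
Lemma RInt_gen_iterated (g : nat -> R -> R) (h : R -> R) j z :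
  derivative_chain g -> (forall k, tends_at_0 (g (S k)) 0) ->
  (forall t, 0 < t < 1 -> continuous (g 0%nat) t) -> (forall t, 0 < t < 1 -> h t = g 0%nat t) -> 0 < z < 1 ->
  RInt_gen (fun t => (z - t) ^ j * h t) (at_right 0) (at_point z) = INR (fact j) * g (S j) z.
Proof.
  intros Hg H0 Hc Hh Hz.
  assert (Hprod : forall P : R * R -> Prop, (forall a, 0 < a < z -> P (a, z)) ->
     filter_prod (at_right 0) (at_point z) P).
  { intros P HP. exists (fun a => 0 < a < z) (fun b => b = z).
    - exists (mkposreal z (proj1 Hz)). intros y Hy Hy0.
      unfold ball in Hy; simpl in Hy; unfold AbsRing_ball, abs, minus, plus, opp in Hy; simpl in Hy.
      apply Rabs_lt_between in Hy. lra.
    - reflexivity.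
    - intros a b Ha ->. auto. }
  apply (is_RInt_gen_unique (V := R_CompleteNormedModule)).
  assert (H : is_RInt_gen (V := R_NormedModule) (fun t => (z - t) ^ j / INR (fact j) * g 0%nat t) (at_right 0) (at_point z) (g (S j) z - 0)).
  { apply is_RInt_gen_antiderivative with (Taylor_antiderivative j g z).
    - apply at_right_proper_filter.
    - apply at_point_filter.
    - apply Hprod. intros a Ha x Hx. simpl in Hx. rewrite Rmin_left, Rmax_right in Hx by lra. split.
      + apply is_derive_Taylor_antiderivative; auto; lra.
      + apply (continuous_mult (fun t => (z - t) ^ j / INR (fact j)) (g 0%nat)); [ | apply Hc; lra].
        apply continuous_of_derive. auto_derive; auto.
    - apply Taylor_antiderivative_at_0; auto.
    - rewrite <- (Taylor_antiderivative_end j g z). intros P HP. unfold filtermap, at_point. apply (locally_singleton _ _ HP). }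
  apply (is_RInt_gen_scal _ (INR (fact j))) in H.
  replace (INR (fact j) * g (S j) z) with (scal (INR (fact j)) (g (S j) z - 0)).
  2:{ unfold scal; simpl; unfold mult; simpl; ring. }
  revert H. apply is_RInt_gen_ext. apply Hprod. intros a Ha x Hx. simpl in Hx.
  rewrite Rmin_left, Rmax_right in Hx by lra. rewrite Hh by lra.
  change (INR (fact j) * ((z - x) ^ j / INR (fact j) * g 0%nat x) = (z - x) ^ j * g 0%nat x).
  field. apply INR_fact_neq_0.
Qed.

(** * The chains that make up the negapolygammas *)

(** (2j+3)(2j+4)...(2j+2+n), the consecutive factors in the denominator of the
    theorem at the summation index j + 1, with n factors. *)
Fixpoint odd_product (n j : nat) : R :=
  match n with O => 1 | S k => odd_product k j * INR (2 * j + 3 + k) end.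

Lemma odd_product_ge_1 n j : 1 <= odd_product n j.
Proof.
  induction n; [simpl; lra | ].
  change (1 <= odd_product n j * INR (2 * j + 3 + n)).
  assert (1 <= INR (2 * j + 3 + n)) by (apply (le_INR 1); lia). nra.
Qed.

Lemma odd_product_shifted m j : odd_product (S m) j = shifted_product (S j) (S m).
Proof.
  unfold shifted_product. replace (S m - 1)%nat with m by lia. induction m.
  - change (1 * INR (2 * j + 3 + 0) = INR (2 * S j + 1)). rewrite Rmult_1_l. f_equal. lia.
  - change (odd_product (S (S m)) j) with (odd_product (S m) j * INR (2 * j + 3 + S m)).
    rewrite IHm. change (prod_f_R0 (fun i => INR (2 * S j + S i)) (S m)) with
      (prod_f_R0 (fun i => INR (2 * S j + S i)) m * INR (2 * S j + S (S m))). f_equal. f_equal. lia.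
Qed.

Definition zeta_coef (n j : nat) : R := zeta (INR (2 * j + 3)) / odd_product n j.

Lemma bounded_seq_div (a b : nat -> R) : (forall j, Rabs (a j) <= zeta (INR 2)) -> (forall j, 1 <= b j) ->
  bounded_seq (fun j => a j / b j).
Proof.
  intros Ha Hb. exists (zeta (INR 2) / 1). intros j. apply Rabs_div_le; auto; lra.
Qed.

Lemma zeta_coef_bound n j : Rabs (zeta_coef n j) <= zeta (INR 2).
Proof.
  replace (zeta (INR 2)) with (zeta (INR 2) / 1) by field.
  apply Rabs_div_le; [lra | apply odd_product_ge_1 | ].
  assert (H := zeta_bounds (2 * j + 3) ltac:(lia)). rewrite Rabs_right; lra.
Qed.

Lemma bounded_zeta_coef n : bounded_seq (zeta_coef n).
Proof. exists (zeta (INR 2)). apply zeta_coef_bound. Qed.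

(** All chains are indexed from 0: position k carries what enters the
    negapolygamma of order k + 1. *)
Definition zeta_chain (k : nat) (z : R) : R := gap_series (zeta_coef (S k)) (k + 3) z.

Lemma derivative_chain_zeta : derivative_chain zeta_chain.
Proof.
  intros k z Hz. unfold zeta_chain.
  replace (gap_series (zeta_coef (S k)) (k + 3) z) with
    (gap_series (fun j => INR (2 * j + (k + 3) + 1) * zeta_coef (S (S k)) j) (k + 3) z).
  - apply (is_derive_gap_series _ (k + 3)); [apply bounded_zeta_coef | rewrite Rabs_right; lra].
  - unfold gap_series. f_equal. apply PSeries_ext. intros j. unfold zeta_coef.
    change (odd_product (S (S k)) j) with (odd_product (S k) j * INR (2 * j + 3 + S k)).
    replace (2 * j + (k + 3) + 1)%nat with (2 * j + 3 + S k)%nat by lia. field. split.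
    + generalize (odd_product_ge_1 (S k) j); lra.
    + apply not_0_INR; lia.
Qed.

Lemma gap_series_at_0 a n : bounded_seq a -> tends_at_0 (gap_series a (S n)) 0.
Proof.
  intros Ha. rewrite <- (gap_series_0 a n) at 2. apply tends_at_0_of_derive.
  eexists. apply is_derive_gap_series; auto. rewrite Rabs_R0. lra.
Qed.

Lemma zeta_chain_at_0 k : tends_at_0 (zeta_chain k) 0.
Proof.
  unfold zeta_chain. replace (k + 3)%nat with (S (k + 2)) by lia. apply gap_series_at_0, bounded_zeta_coef.
Qed.

Definition power_chain (k : nat) (z : R) : R := z ^ k / INR (fact k).

Lemma is_derive_power_chain k z : is_derive (power_chain (S k)) z (power_chain k z).
Proof.
  unfold power_chain.
  apply (is_derive_ext (fun z => / INR (fact (S k)) * z ^ S k)); [intros; real_eq; unfold Rdiv; ring | ].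
  replace (z ^ k / INR (fact k)) with (/ INR (fact (S k)) * (INR (S k) * 1 * z ^ k)).
  - apply is_derive_scal. apply (is_derive_pow (fun x => x) (S k) z 1). auto_derive; auto.
  - rewrite fact_simpl, mult_INR. field. split; [apply INR_fact_neq_0 | apply not_0_INR; lia].
Qed.

Lemma power_chain_0 k : power_chain (S k) 0 = 0.
Proof. unfold power_chain. rewrite pow_i by lia. unfold Rdiv; ring. Qed.

Lemma power_chain_at_0 k : tends_at_0 (power_chain (S k)) 0.
Proof.
  rewrite <- (power_chain_0 k) at 2. apply tends_at_0_of_derive. eexists. apply is_derive_power_chain.
Qed.

Lemma harmonic_succ k : harmonic (S k) = harmonic k + / INR (S k).
Proof. unfold harmonic. apply (sum_n_Sm (fun i => / INR i) 1 k). lia. Qed.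

(** Substitute y = 1/z in ln y / y. *)
Lemma tends_at_0_x_ln : tends_at_0 (fun z => z * ln z) 0.
Proof.
  apply (tends_at_0_ext (fun z => (fun y => - (ln y / y)) (/ z))).
  - intros z Hz. rewrite ln_Rinv by lra. field. lra.
  - apply (filterlim_comp _ _ _ Rinv (fun y => - (ln y / y)) _ (Rbar_locally p_infty)).
    + apply filterlim_Rinv_0_right.
    + replace 0 with (- 0) by ring.
      apply (filterlim_comp _ _ _ (fun y => ln y / y) Ropp _ (locally 0)); [apply is_lim_div_ln_p | apply (filterlim_opp 0)].
Qed.

Definition log_antiderivative (n : nat) (c z : R) : R := z ^ n * (ln z - c).

Lemma is_derive_log_antiderivative n c z : 0 < z ->
  is_derive (log_antiderivative (S n) c) z (INR (S n) * z ^ n * (ln z - c) + z ^ n).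
Proof.
  intros Hz. unfold log_antiderivative.
  replace (INR (S n) * z ^ n * (ln z - c) + z ^ n) with (INR (S n) * 1 * z ^ n * (ln z - c) + z ^ S n * / z)
    by (simpl pow; field; lra).
  apply (is_derive_mult (fun z => z ^ S n) (fun z => ln z - c)); [ | | intros; apply Rmult_comm].
  - apply (is_derive_pow (fun x => x) (S n) z 1). auto_derive; auto.
  - auto_derive; auto. ring.
Qed.

Lemma log_antiderivative_at_0 n c : tends_at_0 (log_antiderivative (S n) c) 0.
Proof.
  assert (H1 : tends_at_0 (fun z => z ^ n) (0 ^ n)).
  { apply (tends_at_0_of_derive (fun z => z ^ n)). auto_derive; auto. }
  assert (H2 : tends_at_0 (fun z => z ^ S n) 0).
  { replace 0 with (0 ^ S n) at 2 by (apply pow_i; lia). apply (tends_at_0_of_derive (fun z => z ^ S n)). auto_derive; auto. }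
  assert (H := tends_at_0_lin _ _ 1 (- c) _ _ (tends_at_0_mult _ _ _ _ H1 tends_at_0_x_ln) H2).
  replace (1 * (0 ^ n * 0) + - c * 0) with 0 in H by ring.
  revert H. apply tends_at_0_ext. intros z _. unfold log_antiderivative. simpl pow. ring.
Qed.

Definition log_chain (k : nat) (z : R) : R := / INR (fact k) * log_antiderivative k (harmonic k) z.

Lemma derivative_chain_log : derivative_chain log_chain.
Proof.
  intros k z Hz. unfold log_chain.
  replace (/ INR (fact k) * log_antiderivative k (harmonic k) z) with
   (/ INR (fact (S k)) * (INR (S k) * z ^ k * (ln z - harmonic (S k)) + z ^ k)).
  - apply is_derive_scal. apply is_derive_log_antiderivative. lra.
  - rewrite fact_simpl, mult_INR, harmonic_succ. unfold log_antiderivative. field.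
    split; [apply INR_fact_neq_0 | apply not_0_INR; lia].
Qed.

Lemma log_chain_at_0 k : tends_at_0 (log_chain (S k)) 0.
Proof.
  assert (H := tends_at_0_lin _ _ (/ INR (fact (S k))) 0 _ _ (log_antiderivative_at_0 k (harmonic (S k))) (log_antiderivative_at_0 k 0)).
  replace (/ INR (fact (S k)) * 0 + 0 * 0) with 0 in H by ring.
  revert H. apply tends_at_0_ext. intros z _. unfold log_chain. ring.
Qed.

Lemma half_of_even i : ((2 * i) / 2 = i)%nat.
Proof. symmetry. apply (Nat.div_unique _ 2 _ 0); lia. Qed.

Lemma half_of_odd i : ((2 * i + 1) / 2 = i)%nat.
Proof. symmetry. apply (Nat.div_unique _ 2 _ 1); lia. Qed.

Lemma even_odd_case k : exists i, (k = 2 * i)%nat \/ (k = 2 * i + 1)%nat.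
Proof. destruct (Nat.Even_or_Odd k) as [[i H] | [i H]]; exists i; lia. Qed.

Lemma half_of_odd_succ i : ((2 * i + 1 + 1) / 2 = S i)%nat.
Proof. replace (2 * i + 1 + 1)%nat with (2 * S i)%nat by lia. apply half_of_even. Qed.

Lemma even_double i : Nat.even (2 * i) = true.
Proof. apply Nat.even_spec. exists i. lia. Qed.

Lemma even_double_plus_1 i : Nat.even (2 * i + 1) = false.
Proof. rewrite <- Nat.negb_odd. replace (Nat.odd (2 * i + 1)) with true; auto. symmetry. apply Nat.odd_spec. exists i. lia. Qed.

(** The signs of the antiderivatives of the Clausen functions have period 4. *)
Lemma sign_step k : (-1) ^ k * (-1) ^ (k / 2) = (-1) ^ ((k + 1) / 2).
Proof.
  destruct (even_odd_case k) as [i [-> | ->]].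
  - rewrite half_of_even, half_of_odd, pow_1_even. ring.
  - rewrite half_of_odd, half_of_odd_succ, pow_add, pow_1_even. simpl. ring.
Qed.

(** At order 1 the conditionally convergent cosine series is replaced by its sum
    on (0, 2 PI), the function that [is_derive_Clausen_2] produces. *)
Definition Clausen_ext (n : nat) (x : R) : R :=
  match n with 1%nat => - ln (2 * sin (x / 2)) | _ => Clausen n x end.

(** The antiderivatives of - ln (2 sin (PI z)) without integration constants. *)
Definition Clausen_chain (k : nat) (z : R) : R :=
  (-1) ^ (k / 2) / (2 * PI) ^ k * Clausen_ext (k + 1) (2 * PI * z).

Lemma is_derive_Clausen_ext k x : 0 < x < 2 * PI ->
  is_derive (Clausen_ext (S k + 1)) x ((-1) ^ S k * - Clausen_ext (k + 1) x).
Proof.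
  intros Hx. destruct k as [ | k].
  - replace ((-1) ^ 1 * - Clausen_ext (0 + 1) x) with (- ln (2 * sin (x / 2))) by (simpl; ring).
    apply (is_derive_Clausen_2 x Hx).
  - replace (S (S k) + 1)%nat with (S (S (S k))) by lia. replace (S k + 1)%nat with (S (S k)) by lia.
    replace ((-1) ^ S (S k) * - Clausen_ext (S (S k)) x) with ((if Nat.even (S (S k)) then -1 else 1) * Clausen (S (S k)) x).
    + apply is_derive_Clausen. lia.
    + change (Clausen_ext (S (S k)) x) with (Clausen (S (S k)) x).
      destruct (even_odd_case (S (S k))) as [i [-> | ->]].
      * rewrite even_double, pow_1_even. ring.
      * rewrite even_double_plus_1, pow_add, pow_1_even. simpl. ring.
Qed.

Lemma two_PI_nz : 2 * PI <> 0.
Proof. generalize PI_RGT_0. lra. Qed.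

Lemma two_PI_range z : 0 < z < 1 -> 0 < 2 * PI * z < 2 * PI.
Proof. intros Hz. generalize PI_RGT_0. nra. Qed.

Lemma derivative_chain_Clausen : derivative_chain Clausen_chain.
Proof.
  intros k z Hz. assert (HP := two_PI_nz). unfold Clausen_chain.
  replace ((-1) ^ (k / 2) / (2 * PI) ^ k * Clausen_ext (k + 1) (2 * PI * z)) with
    ((-1) ^ (S k / 2) / (2 * PI) ^ S k * (2 * PI * ((-1) ^ S k * - Clausen_ext (k + 1) (2 * PI * z)))).
  - apply is_derive_scal.
    apply (is_derive_comp (V := R_NormedModule) (Clausen_ext (S k + 1)) (fun z => 2 * PI * z)).
    + apply is_derive_Clausen_ext, two_PI_range; auto.
    + auto_derive; auto; ring.
  - assert (E := sign_step k). replace (k + 1)%nat with (S k) in E at 1 by lia. rewrite <- E.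
    assert (E2 : (-1) ^ k * (-1) ^ k = 1) by (rewrite <- Rpow_mult_distr; replace (-1 * -1) with 1 by ring; apply pow1).
    replace ((-1) ^ k * (-1) ^ (k / 2) / (2 * PI) ^ S k * (2 * PI * ((-1) ^ S k * - Clausen_ext (k + 1) (2 * PI * z))))
      with (((-1) ^ k * (-1) ^ k) * (-1) ^ (k / 2) / (2 * PI) ^ k * Clausen_ext (k + 1) (2 * PI * z)).
    + rewrite E2. rewrite Rmult_1_l. reflexivity.
    + rewrite <- !tech_pow_Rmult. generalize ((-1) ^ (k / 2)) ((-1) ^ k). intros w v. field. split; [apply pow_nonzero; auto | ].
      generalize PI_RGT_0; lra.
Qed.

Lemma Clausen_chain_at_0 k : tends_at_0 (Clausen_chain (S k)) (Clausen_chain (S k) 0).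
Proof.
  apply tends_at_0_of_continuous. unfold Clausen_chain.
  apply (continuous_scal_r (K := R_AbsRing) (V := R_NormedModule)).
  apply (continuous_comp (fun z => 2 * PI * z) (Clausen_ext (S k + 1))).
  - apply continuous_of_derive. auto_derive; auto.
  - replace (S k + 1)%nat with (S (S k)) by lia. apply (continuous_Clausen (S (S k))). lia.
Qed.

Definition correction_coef (j : nat) : R := - ((-1) ^ j * zeta (INR (2 * j + 1)) / (2 * PI) ^ (2 * j)).

(** The polynomials that cancel the values of the Clausen chain at 0.  Passing
    from k to k + 1 integrates the polynomial, and adds a new constant when k + 1
    is even. *)
Definition correction_chain (k : nat) (z : R) : R :=
  sum_n_m (fun j => correction_coef j * power_chain (k - 2 * j) z) 1 (k / 2).

Lemma is_derive_sum_n_m (f df : nat -> R -> R) a b z :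
  (forall k, (a <= k <= b)%nat -> is_derive (f k) z (df k z)) ->
  is_derive (fun z => sum_n_m (fun k => f k z) a b) z (sum_n_m (fun k => df k z) a b).
Proof.
  revert a. induction b; intros a H.
  - destruct a.
    + rewrite sum_n_n. apply (is_derive_ext (f 0%nat)); [intros; rewrite sum_n_n; auto | auto].
    + rewrite sum_n_m_zero by lia. apply (is_derive_ext (fun _ => 0)).
      * intros t. rewrite sum_n_m_zero by lia. auto.
      * apply (is_derive_const (K := R_AbsRing) (V := R_NormedModule)).
  - destruct (le_lt_dec a (S b)) as [h | h].
    + rewrite sum_n_Sm by auto.
      apply (is_derive_ext (fun z => sum_n_m (fun k => f k z) a b + f (S b) z)).
      * intros t. rewrite sum_n_Sm by auto. auto.
      * apply (is_derive_plus (V := R_NormedModule)); [apply IHb; intros; apply H; lia | apply H; lia].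
    + rewrite sum_n_m_zero by lia. apply (is_derive_ext (fun _ => 0)).
      * intros t. rewrite sum_n_m_zero by lia. auto.
      * apply (is_derive_const (K := R_AbsRing) (V := R_NormedModule)).
Qed.

Lemma is_derive_correction_chain k z : is_derive (correction_chain (S k)) z (correction_chain k z).
Proof.
  unfold correction_chain.
  (* When k + 1 is even, the last summand of the (k+1)-st polynomial is constant. *)
  set (df := fun j z => if le_lt_dec (2 * j) k then correction_coef j * power_chain (k - 2 * j) z else 0).
  replace (sum_n_m (fun j => correction_coef j * power_chain (k - 2 * j) z) 1 (k / 2))
    with (sum_n_m (fun j => df j z) 1 (S k / 2)).
  - apply (is_derive_sum_n_m (fun j z => correction_coef j * power_chain (S k - 2 * j) z) df).
    intros j Hj. unfold df. destruct (le_lt_dec (2 * j) k) as [h | h].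
    + apply is_derive_scal. replace (S k - 2 * j)%nat with (S (k - 2 * j)) by lia. apply is_derive_power_chain.
    + assert (Hj2 : (2 * j <= S k)%nat) by (generalize (Nat.Div0.mul_div_le (S k) 2); lia).
      replace (S k - 2 * j)%nat with 0%nat by lia.
      apply (is_derive_ext (fun _ => correction_coef j * 1)).
      * intros t. unfold power_chain. simpl. real_eq. field.
      * apply (is_derive_const (K := R_AbsRing) (V := R_NormedModule)).
  - assert (Hd : forall j, (2 * j <= k)%nat -> df j z = correction_coef j * power_chain (k - 2 * j) z).
    { intros j Hj. unfold df. destruct (le_lt_dec (2 * j) k); [auto | lia]. }
    destruct (even_odd_case k) as [i [E | E]].
    + replace (S k / 2)%nat with i by (subst k; replace (S (2 * i)) with (2 * i + 1)%nat by lia; rewrite half_of_odd; auto).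
      replace (k / 2)%nat with i by (subst k; rewrite half_of_even; auto).
      apply sum_n_m_ext_loc. intros j Hj. apply Hd. lia.
    + replace (S k / 2)%nat with (S i) by (subst k; replace (S (2 * i + 1)) with (2 * i + 1 + 1)%nat by lia; rewrite half_of_odd_succ; auto).
      replace (k / 2)%nat with i by (subst k; rewrite half_of_odd; auto).
      rewrite sum_n_Sm by lia. unfold df at 2. destruct (le_lt_dec (2 * S i) k); [lia | ].
      change (plus ?a 0) with (a + 0). rewrite Rplus_0_r.
      apply sum_n_m_ext_loc. intros j Hj. apply Hd. lia.
Qed.

(** For even order of the Clausen function both terms vanish at 0; for odd order
    the cosine series is a zeta value, which the constant term of the correction
    cancels. *)
Lemma Clausen_correction_cancel_0 k : Clausen_chain (S k) 0 + correction_chain (S k) 0 = 0.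
Proof.
  unfold Clausen_chain, correction_chain. rewrite Rmult_0_r.
  replace (Clausen_ext (S k + 1) 0) with (Clausen (S k + 1) 0) by (replace (S k + 1)%nat with (S (S k)) by lia; reflexivity).
  assert (HZ : forall i, (2 * i < S k)%nat -> sum_n_m (fun j => correction_coef j * power_chain (S k - 2 * j) 0) 1 i = 0).
  { intros i Hi. transitivity (sum_n_m (fun _ => 0) 1 i); [ | apply (sum_n_m_const_zero (G := R_AbelianMonoid))]. apply sum_n_m_ext_loc.
    intros j Hj. replace (S k - 2 * j)%nat with (S (k - 2 * j)) by lia. rewrite power_chain_0.
    apply Rmult_0_r. }
  destruct (even_odd_case (S k)) as [i [E | E]]; rewrite E in *.
  - destruct i as [ | i]; [lia | ].
    rewrite half_of_even, sum_n_Sm by lia. rewrite HZ by lia.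
    rewrite Clausen_odd_0 by apply even_double_plus_1.
    rewrite Nat.sub_diag. unfold correction_coef, power_chain. change (plus 0 ?a) with (0 + a).
    simpl (fact 0). rewrite pow_O. change (INR 1) with 1. field. apply pow_nonzero, two_PI_nz.
  - rewrite half_of_odd, HZ by lia. rewrite Clausen_even_0.
    + ring.
    + replace (2 * i + 1 + 1)%nat with (2 * S i)%nat by lia. apply even_double.
Qed.

Lemma correction_chain_at_0 k : tends_at_0 (correction_chain (S k)) (correction_chain (S k) 0).
Proof. apply tends_at_0_of_derive. eexists. apply is_derive_correction_chain. Qed.

(** * Negapolygammas and the moment identity *)

(** The sum of all pieces, nested so that [derivative_chain_lin] and
    [tends_at_0_lin] apply step by step. *)
Definition negapolygamma_chain (k : nat) (z : R) : R :=
  -1 * zeta_chain k z + 1 * (- EulerMascheroni * power_chain (S k) z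
   + 1 * (- / 2 * log_chain k z + 1 * (ln (2 * PI) / 2 * power_chain k z
   + / 2 * (1 * Clausen_chain k z + 1 * correction_chain k z)))).

Lemma derivative_chain_negapolygamma : derivative_chain negapolygamma_chain.
Proof.
  unfold negapolygamma_chain.
  apply derivative_chain_lin; [apply derivative_chain_zeta | ].
  apply (derivative_chain_lin (fun k => power_chain (S k))); [intros k z _; apply is_derive_power_chain | ].
  apply derivative_chain_lin; [apply derivative_chain_log | ].
  apply (derivative_chain_lin power_chain); [intros k z _; apply is_derive_power_chain | ].
  apply derivative_chain_lin; [apply derivative_chain_Clausen | ].
  intros k z _; apply is_derive_correction_chain.
Qed.

Lemma negapolygamma_chain_at_0 k : tends_at_0 (negapolygamma_chain (S k)) 0.
Proof.
  unfold negapolygamma_chain.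
  replace 0 with (-1 * 0 + 1 * (- EulerMascheroni * 0 + 1 * (- / 2 * 0 + 1 * (ln (2 * PI) / 2 * 0
    + / 2 * (1 * Clausen_chain (S k) 0 + 1 * correction_chain (S k) 0))))) at 2.
  2:{ rewrite !Rmult_1_l, Clausen_correction_cancel_0. ring. }
  apply tends_at_0_lin; [apply zeta_chain_at_0 | ].
  apply (tends_at_0_lin (power_chain (S (S k)))); [apply power_chain_at_0 | ].
  apply tends_at_0_lin; [apply log_chain_at_0 | ].
  apply (tends_at_0_lin (power_chain (S k))); [apply power_chain_at_0 | ].
  apply tends_at_0_lin; [apply Clausen_chain_at_0 | ].
  apply correction_chain_at_0.
Qed.

Lemma negapolygamma_chain_0 z : negapolygamma_chain 0 z =
  - zeta_chain 0 z - EulerMascheroni * z - / 2 * ln z + / 2 * ln (2 * PI) - / 2 * ln (2 * sin (PI * z)).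
Proof.
  unfold negapolygamma_chain, log_chain, log_antiderivative, power_chain, Clausen_chain, correction_chain.
  change (0 / 2)%nat with 0%nat. rewrite sum_n_m_zero by lia. change zero with 0.
  replace (harmonic 0) with 0 by (unfold harmonic; rewrite sum_n_m_zero by lia; reflexivity).
  simpl Clausen_ext. replace (2 * PI * z / 2) with (PI * z) by field. simpl. field.
Qed.

Lemma logGamma_eq z : 0 < z < 1 -> logGamma z = negapolygamma_chain 0 z.
Proof.
  intros Hz. rewrite negapolygamma_chain_0. assert (HP := PI_RGT_0).
  assert (HS := is_series_odd_zeta z Hz).
  assert (HG := is_series_gap (zeta_coef 1) 3 z (bounded_zeta_coef 1) ltac:(rewrite Rabs_right; lra)).
  assert (E : zeta_chain 0 z = - EulerMascheroni * z - logGamma z - ln z - / 2 * ln (sin (PI * z) / (PI * z))).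
  { unfold zeta_chain. simpl Nat.add.
    rewrite <- (is_series_unique _ _ HS). symmetry. rewrite <- (is_series_unique _ _ HG). apply Series_ext.
    intros j. unfold zeta_coef. do 2 f_equal.
    change (odd_product 1 j) with (1 * INR (2 * j + 3 + 0)). rewrite Nat.add_0_r. ring. }
  assert (Hs : 0 < sin (PI * z)) by (apply sin_gt_0; nra).
  rewrite E, ln_div, !ln_mult by nra. lra.
Qed.

Lemma continuous_negapolygamma_chain_0 z : 0 < z < 1 -> continuous (negapolygamma_chain 0) z.
Proof.
  intros Hz. assert (HP := PI_RGT_0).
  assert (Hs : 0 < sin (PI * z)) by (apply sin_gt_0; nra).
  apply (continuous_ext (fun z => -1 * zeta_chain 0 z + (- EulerMascheroni * z - / 2 * ln z + / 2 * ln (2 * PI) - / 2 * ln (2 * sin (PI * z))))).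
  { intros t. rewrite negapolygamma_chain_0. real_eq. ring. }
  apply (continuous_plus (V := R_NormedModule)).
  - apply continuous_of_derive. apply ex_derive_scal.
    eexists. apply (is_derive_gap_series (zeta_coef 1) 2); [apply bounded_zeta_coef | rewrite Rabs_right; lra].
  - apply continuous_of_derive. auto_derive. repeat split; lra.
Qed.

(** Position 0 is [is_series_odd_zeta]; the others follow from Cauchy's formula,
    since the chain vanishes at 0+ from position 1 on. *)
Lemma negapolygamma_eq k z : 0 < z < 1 -> negapolygamma (S k) z = negapolygamma_chain k z.
Proof.
  intros Hz. destruct k as [ | j].
  - apply logGamma_eq; auto.
  - unfold negapolygamma.
    rewrite (RInt_gen_iterated negapolygamma_chain logGamma j z); auto.
    + field. apply INR_fact_neq_0.
    + apply derivative_chain_negapolygamma.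
    + apply negapolygamma_chain_at_0.
    + apply continuous_negapolygamma_chain_0.
    + apply logGamma_eq.
Qed.

Lemma is_derive_lin (f g : R -> R) a b z f' g' : is_derive f z f' -> is_derive g z g' ->
  is_derive (fun z => a * f z + b * g z) z (a * f' + b * g').
Proof.
  intros Hf Hg. apply (is_derive_plus (V := R_NormedModule)); apply is_derive_scal; auto.
Qed.

Definition moment_coef (p n j : nat) : R := zeta_coef (S n) j / INR (2 * j + (p + (n + 3)) + 1).

(** [zeta_moment] and the three functions after it are the antiderivatives of
    z^p times the n-th entry of the corresponding chain that tend to 0 at 0+. *)
Definition zeta_moment (p n : nat) : R -> R := gap_series (moment_coef p n) (S (p + (n + 3))).

Definition power_moment (p n : nat) (z : R) : R := / (INR (fact n) * INR (S (p + n))) * z ^ S (p + n).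

Definition log_moment (p n : nat) (z : R) : R :=
  / (INR (fact n) * INR (S (p + n))) * log_antiderivative (S (p + n)) (harmonic n + / INR (S (p + n))) z.

Definition correction_moment (p n : nat) (z : R) : R :=
  sum_n_m (fun j => correction_coef j * power_moment p (n - 2 * j) z) 1 (n / 2).

(** The limit at 0+ of the repeated integration by parts of the Clausen chain. *)
Definition Clausen_moment_constant (p n : nat) : R := (-1) ^ p * INR (fact p) * Clausen_chain (S n + p) 0.

Lemma bounded_moment_coef p n : bounded_seq (moment_coef p n).
Proof.
  apply (bounded_seq_div (zeta_coef (S n)) (fun j => INR (2 * j + (p + (n + 3)) + 1))); [apply zeta_coef_bound | ]. intros j. apply (le_INR 1). lia.
Qed.

Lemma is_derive_zeta_moment p n z : 0 < z < 1 -> is_derive (zeta_moment p n) z (z ^ p * zeta_chain n z).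
Proof.
  intros Hz. unfold zeta_moment.
  replace (z ^ p * zeta_chain n z) with (gap_series (fun j => INR (2 * j + (p + (n + 3)) + 1) * moment_coef p n j) (p + (n + 3)) z).
  - apply is_derive_gap_series; [apply bounded_moment_coef | rewrite Rabs_right; lra].
  - unfold zeta_chain, gap_series. rewrite pow_add, Rmult_assoc. do 2 f_equal.
    apply PSeries_ext. intros j. unfold moment_coef. field. apply not_0_INR; lia.
Qed.

Lemma is_derive_power_moment p n z : is_derive (power_moment p n) z (z ^ p * power_chain n z).
Proof.
  unfold power_moment, power_chain.
  replace (z ^ p * (z ^ n / INR (fact n))) with (/ (INR (fact n) * INR (S (p + n))) * (INR (S (p + n)) * 1 * z ^ (p + n))).
  - apply is_derive_scal. apply (is_derive_pow (fun x => x) (S (p + n)) z 1). auto_derive; auto.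
  - rewrite pow_add. field. split; [apply INR_fact_neq_0 | apply not_0_INR; lia].
Qed.

Lemma is_derive_log_moment p n z : 0 < z -> is_derive (log_moment p n) z (z ^ p * log_chain n z).
Proof.
  intros Hz. unfold log_moment.
  assert (HN : INR (S (p + n)) <> 0) by (apply not_0_INR; lia).
  replace (z ^ p * log_chain n z) with (/ (INR (fact n) * INR (S (p + n))) *
     (INR (S (p + n)) * z ^ (p + n) * (ln z - (harmonic n + / INR (S (p + n)))) + z ^ (p + n))).
  - apply is_derive_scal. apply is_derive_log_antiderivative; auto.
  - unfold log_chain, log_antiderivative. rewrite pow_add. field. split; [apply INR_fact_neq_0 | auto].
Qed.

Lemma is_derive_correction_moment p n z : is_derive (correction_moment p n) z (z ^ p * correction_chain n z).
Proof.
  unfold correction_moment, correction_chain.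
  replace (z ^ p * sum_n_m (fun j => correction_coef j * power_chain (n - 2 * j) z) 1 (n / 2)) with
    (sum_n_m (fun j => correction_coef j * (z ^ p * power_chain (n - 2 * j) z)) 1 (n / 2)).
  - apply (is_derive_sum_n_m (fun j z => correction_coef j * power_moment p (n - 2 * j) z)
      (fun j z => correction_coef j * (z ^ p * power_chain (n - 2 * j) z))).
    intros j _. apply is_derive_scal. apply is_derive_power_moment.
  - rewrite <- (sum_n_m_mult_l (K := R_Ring) (z ^ p)). apply sum_n_m_ext. intros j.
    change (correction_coef j * (z ^ p * power_chain (n - 2 * j) z) = z ^ p * (correction_coef j * power_chain (n - 2 * j) z)). ring.
Qed.

Lemma power_moment_0 p n : power_moment p n 0 = 0.
Proof. unfold power_moment. rewrite pow_i by lia. ring. Qed.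

Lemma correction_moment_0 p n : correction_moment p n 0 = 0.
Proof.
  unfold correction_moment. transitivity (sum_n_m (fun _ => 0) 1 (n / 2)); [ | apply (sum_n_m_const_zero (G := R_AbelianMonoid))].
  apply sum_n_m_ext. intros j. rewrite power_moment_0. apply Rmult_0_r.
Qed.

(** Both sides are antiderivatives of z^p times the n-th entry of the chain, and
    both tend to 0 at 0+. *)
Lemma by_parts_negapolygamma p n z : 0 < z < 1 ->
  by_parts p negapolygamma_chain (S n) z =
  - zeta_moment p n z - EulerMascheroni * power_moment p (S n) z - / 2 * log_moment p n z
  + ln (2 * PI) / 2 * power_moment p n z
  + / 2 * (by_parts p Clausen_chain (S n) z + correction_moment p n z - Clausen_moment_constant p n).
Proof.
  intros Hz.
  set (E := fun z => -1 * zeta_moment p n z + 1 * (- EulerMascheroni * power_moment p (S n) z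
   + 1 * (- / 2 * log_moment p n z + 1 * (ln (2 * PI) / 2 * power_moment p n z
   + / 2 * (1 * by_parts p Clausen_chain (S n) z + 1 * (1 * correction_moment p n z + -1 * Clausen_moment_constant p n)))))).
  transitivity (E z); [ | unfold E; field].
  revert z Hz.
  apply (antiderivative_unique _ _ (fun z => z ^ p * negapolygamma_chain n z)).
  - intros z Hz. apply is_derive_by_parts; auto. apply derivative_chain_negapolygamma.
  - intros z Hz. unfold E.
    replace (z ^ p * negapolygamma_chain n z) with
     (-1 * (z ^ p * zeta_chain n z) + 1 * (- EulerMascheroni * (z ^ p * power_chain (S n) z)
      + 1 * (- / 2 * (z ^ p * log_chain n z) + 1 * (ln (2 * PI) / 2 * (z ^ p * power_chain n z)
      + / 2 * (1 * (z ^ p * Clausen_chain n z) + 1 * (1 * (z ^ p * correction_chain n z) + -1 * 0))))))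
     by (unfold negapolygamma_chain; ring).
    apply is_derive_lin; [apply is_derive_zeta_moment; auto | ].
    apply is_derive_lin; [apply is_derive_power_moment | ].
    apply is_derive_lin; [apply is_derive_log_moment; lra | ].
    apply is_derive_lin; [apply is_derive_power_moment | ].
    apply is_derive_lin; [apply is_derive_by_parts; auto; apply derivative_chain_Clausen | ].
    apply (is_derive_lin (correction_moment p n) (fun _ => Clausen_moment_constant p n)).
    + apply is_derive_correction_moment.
    + apply (is_derive_const (K := R_AbsRing) (V := R_NormedModule)).
  - assert (H := by_parts_at_0 p negapolygamma_chain (S n) (fun _ => 0)).
    rewrite Rmult_0_r in H. apply H. intros [ | k] Hk; [lia | ]. apply negapolygamma_chain_at_0.
  - assert (Hpow : forall q, tends_at_0 (power_moment p q) 0).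
    { intros q. rewrite <- (power_moment_0 p q) at 2. apply tends_at_0_of_derive. eexists. apply is_derive_power_moment. }
    unfold E.
    replace 0 with (-1 * 0 + 1 * (- EulerMascheroni * 0 + 1 * (- / 2 * 0 + 1 * (ln (2 * PI) / 2 * 0
     + / 2 * (1 * Clausen_moment_constant p n + 1 * (1 * 0 + -1 * Clausen_moment_constant p n)))))) at 2 by ring.
    apply tends_at_0_lin; [apply gap_series_at_0, bounded_moment_coef | ].
    apply (tends_at_0_lin (power_moment p (S n))); [apply Hpow | ].
    apply tends_at_0_lin.
    { assert (H := tends_at_0_lin _ _ (/ (INR (fact n) * INR (S (p + n)))) 0 _ _
        (log_antiderivative_at_0 (p + n) (harmonic n + / INR (S (p + n)))) (log_antiderivative_at_0 (p + n) 0)).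
      replace (/ (INR (fact n) * INR (S (p + n))) * 0 + 0 * 0) with 0 in H by ring.
      revert H. apply tends_at_0_ext. intros z _. unfold log_moment. ring. }
    apply (tends_at_0_lin (power_moment p n)); [apply Hpow | ].
    apply tends_at_0_lin.
    { apply (by_parts_at_0 p Clausen_chain (S n) (fun k => Clausen_chain k 0)).
      intros [ | k] Hk; [lia | ]. apply Clausen_chain_at_0. }
    apply (tends_at_0_lin (correction_moment p n) (fun _ => Clausen_moment_constant p n)).
    + rewrite <- (correction_moment_0 p n) at 2. apply tends_at_0_of_derive. eexists. apply is_derive_correction_moment.
    + apply filterlim_const.
Qed.

Lemma sum_n_m_shift (a : nat -> R) m q : sum_n_m a m (m + q) = sum_n_m (fun i => a (m + i)%nat) 0 q.
Proof.
  revert a. induction m; intros a; [reflexivity | ].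
  simpl Nat.add. rewrite <- (sum_n_m_S a m (m + q)). rewrite (IHm (fun k => a (S k))). reflexivity.
Qed.

Lemma kronecker_half N : kronecker (INR (N / 2)) (INR N / 2) = if Nat.even N then 1 else 0.
Proof.
  unfold kronecker. destruct (even_odd_case N) as [i [-> | ->]].
  - rewrite half_of_even, even_double. destruct (Req_EM_T _ _) as [h | h]; auto.
    exfalso; apply h. rewrite mult_INR. simpl. field.
  - rewrite half_of_odd, even_double_plus_1. destruct (Req_EM_T _ _) as [h | h]; auto.
    exfalso. rewrite plus_INR, mult_INR in h. simpl in h. lra.
Qed.

(** A sine series vanishes at 0 and a cosine series is a zeta value there, hence
    the parity condition on p + m, with m = n + 1. *)
Lemma Clausen_moment_constant_eq p n : Clausen_moment_constant p n =
  (-1) ^ S n * INR (fact p) * (kronecker (INR ((p + S n) / 2)) (INR (p + S n) / 2)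
    * ((-1) ^ ((p + S n) / 2) * zeta (INR (p + S n + 1)) / (2 * PI) ^ (p + S n))).
Proof.
  unfold Clausen_moment_constant, Clausen_chain. rewrite kronecker_half.
  replace (S n + p)%nat with (p + S n)%nat by lia. rewrite Rmult_0_r.
  replace (Clausen_ext (p + S n + 1) 0) with (Clausen (p + S n + 1) 0)
    by (replace (p + S n + 1)%nat with (S (S (p + n))) by lia; reflexivity).
  assert (HP : (2 * PI) ^ (p + S n) <> 0) by apply pow_nonzero, two_PI_nz.
  assert (E2 : (-1) ^ S n * (-1) ^ S n = 1) by (rewrite <- Rpow_mult_distr; replace (-1 * -1) with 1 by ring; apply pow1).
  assert (Ep : (-1) ^ p = (-1) ^ S n * (-1) ^ (p + S n)) by (rewrite pow_add; transitivity ((-1) ^ p * ((-1) ^ S n * (-1) ^ S n)); [rewrite E2; ring | ring]).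
  rewrite Ep. destruct (even_odd_case (p + S n)) as [i [E | E]]; rewrite E in *.
  - rewrite even_double, half_of_even, pow_1_even, Clausen_odd_0 by apply even_double_plus_1. field. auto.
  - rewrite even_double_plus_1, Clausen_even_0; [ring | ].
    replace (2 * i + 1 + 1)%nat with (2 * S i)%nat by lia. apply even_double.
Qed.

(** * The closed form, term by term *)

(** Here and below m = n + 1, and z^(p+n+2) is the power z^(m+p+1) by which
    [by_parts_negapolygamma] is divided. *)
Lemma normalised_negapolygamma_sum p n z : 0 < z < 1 ->
  sum_n_m (fun k : nat =>
           INR (fact p) * (-1) ^ k * negapolygamma (k + S n + 1) z
             / (INR (fact (p - k)) * z ^ (S n + k + 1))) 0 p
  = by_parts p negapolygamma_chain (S n) z / z ^ (p + n + 2).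
Proof.
  intros Hz. rewrite by_parts_eq_sum. unfold Rdiv at 2.
  rewrite <- (sum_n_m_mult_r (K := R_Ring)). apply sum_n_m_ext_loc. intros k Hk.
  replace (k + S n + 1)%nat with (S (S n + k)) by lia. rewrite negapolygamma_eq by auto.
  replace (p + n + 2)%nat with ((p - k) + (S n + k + 1))%nat by lia. rewrite (pow_add z (p - k)).
  change (INR (fact p) * (-1) ^ k * negapolygamma_chain (S n + k) z / (INR (fact (p - k)) * z ^ (S n + k + 1)) =
   (-1) ^ k * INR (fact p) / INR (fact (p - k)) * z ^ (p - k) * negapolygamma_chain (S n + k) z * / (z ^ (p - k) * z ^ (S n + k + 1))).
  field. repeat split; try (apply pow_nonzero; lra). apply INR_fact_neq_0.
Qed.

Lemma normalised_Clausen_sum p n z : 0 < z < 1 ->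
  (-1) ^ S n * INR (fact p) / (2 * z) *
  sum_n_m (fun k : nat =>
                (-1) ^ ((k + 1) / 2)
                  / (INR (fact (p + S n - k)) * (2 * PI * z) ^ k)
                  * Clausen (k + 1) (2 * PI * z)) (S n) (S n + p)
  = / 2 * by_parts p Clausen_chain (S n) z / z ^ (p + n + 2).
Proof.
  intros Hz. rewrite by_parts_eq_sum, sum_n_m_shift.
  match goal with |- ?L = ?X / ?Y => change (L = X * / Y) end.
  rewrite <- (sum_n_m_mult_l (K := R_Ring) (/ 2)), <- (sum_n_m_mult_r (K := R_Ring)), <- (sum_n_m_mult_l (K := R_Ring)).
  apply sum_n_m_ext_loc. intros k Hk. set (N := (S n + k)%nat).
  assert (HN : Clausen_chain N z = (-1) ^ (N / 2) / (2 * PI) ^ N * Clausen (N + 1) (2 * PI * z)).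
  { unfold Clausen_chain. replace (N + 1)%nat with (S (S (n + k))) by lia. reflexivity. }
  repeat change (mult ?a ?b) with (a * b). rewrite HN, <- sign_step.
  replace (p + S n - N)%nat with (p - k)%nat by lia.
  rewrite (Rpow_mult_distr (2 * PI) z).
  assert (Es : (-1) ^ S n * (-1) ^ N = (-1) ^ k).
  { unfold N. rewrite (pow_add (-1)). transitivity (((-1) ^ S n * (-1) ^ S n) * (-1) ^ k); [ring | ].
    rewrite <- Rpow_mult_distr. replace (-1 * -1) with 1 by ring. rewrite pow1. ring. }
  rewrite <- Es.
  replace (p + n + 2)%nat with ((p - k) + N + 1)%nat by lia. rewrite !(pow_add z), pow_1.
  generalize ((-1) ^ (N / 2)). intros w. real_eq.
  field. repeat split; try (apply pow_nonzero; lra); try lra; [apply pow_nonzero, two_PI_nz | apply INR_fact_neq_0].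
Qed.

Lemma normalised_correction_sum p n z : 0 < z < 1 ->
  / (2 * z) * sum_n_m (fun k : nat =>
               (-1) ^ k * zeta (INR (2 * k + 1))
                 / (INR (fact (n - 2 * k)) * INR (S n + p - 2 * k)
                      * (2 * PI * z) ^ (2 * k)))
             1 (n / 2)
  = - (/ 2 * correction_moment p n z / z ^ (p + n + 2)).
Proof.
  intros Hz. unfold correction_moment.
  transitivity (- / 2 * sum_n_m (fun j : nat => correction_coef j * power_moment p (n - 2 * j) z) 1 (n / 2) * / z ^ (p + n + 2)).
  2: { unfold Rdiv. ring. }
  rewrite <- (sum_n_m_mult_l (K := R_Ring) (- / 2)), <- (sum_n_m_mult_r (K := R_Ring)), <- (sum_n_m_mult_l (K := R_Ring)).
  apply sum_n_m_ext_loc. intros k Hk. repeat change (mult ?a ?b) with (a * b).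
  assert (H2 : (2 * k <= n)%nat) by (generalize (Nat.Div0.mul_div_le n 2); lia).
  unfold correction_coef, power_moment.
  replace (S n + p - 2 * k)%nat with (S (p + (n - 2 * k))) by lia.
  replace (p + n + 2)%nat with (S (p + (n - 2 * k)) + 2 * k + 1)%nat by lia.
  rewrite (Rpow_mult_distr (2 * PI) z), !(pow_add z), pow_1.
  generalize ((-1) ^ k). intros w. real_eq. field.
  repeat split; try (apply pow_nonzero; lra); try lra; try apply INR_fact_neq_0; try (apply not_0_INR; lia);
    try apply pow_nonzero, two_PI_nz.
Qed.

Lemma is_series_zeta_moment p n z : 0 < z < 1 ->
  is_series
    (fun j : nat =>
         zeta (INR (2 * S j + 1)) * z ^ (2 * S j)
         / (shifted_product (S j) (S n) * INR (2 * S j + S n + 1 + p)))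
    (zeta_moment p n z / z ^ (p + n + 2)).
Proof.
  intros Hz.
  assert (H := is_series_gap _ (S (p + (n + 3))) z (bounded_moment_coef p n) ltac:(rewrite Rabs_right; lra)).
  apply (is_series_scal_l (K := R_AbsRing) (V := R_NormedModule) (/ z ^ (p + n + 2))) in H.
  replace (zeta_moment p n z / z ^ (p + n + 2)) with (scal (/ z ^ (p + n + 2)) (gap_series (moment_coef p n) (S (p + (n + 3))) z)).
  2:{ unfold zeta_moment, Rdiv. apply Rmult_comm. }
  revert H. apply is_series_ext. intros j.
  change (/ z ^ (p + n + 2) * (moment_coef p n j * z ^ (2 * j + S (p + (n + 3))))
   = zeta (INR (2 * S j + 1)) * z ^ (2 * S j) / (shifted_product (S j) (S n) * INR (2 * S j + S n + 1 + p))).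
  unfold moment_coef, zeta_coef. rewrite <- odd_product_shifted.
  replace (2 * j + S (p + (n + 3)))%nat with (2 * S j + (p + n + 2))%nat by lia.
  replace (2 * S j + 1)%nat with (2 * j + 3)%nat by lia.
  replace (2 * S j + S n + 1 + p)%nat with (2 * j + (p + (n + 3)) + 1)%nat by lia.
  rewrite (pow_add z (2 * S j)). field. repeat split; try (apply pow_nonzero; lra); try (apply not_0_INR; lia).
  generalize (odd_product_ge_1 (S n) j); lra.
Qed.

Theorem mainTheorem10 (p m : nat) (z : R) (hm : (1 <= m)%nat)
    (hz0 : 0 < z) (hz1 : z < 1) :
  is_series
    (fun j : nat =>
       let n := S j in
       zeta (INR (2 * n + 1)) * z ^ (2 * n)
         / (shifted_product n m * INR (2 * n + m + 1 + p)))
    (- sum_n_m (fun k : nat =>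
           INR (fact p) * (-1) ^ k * negapolygamma (k + m + 1) z
             / (INR (fact (p - k)) * z ^ (m + k + 1)))
         0 p
     + (-1) ^ m * INR (fact p) / (2 * z)
         * (sum_n_m (fun k : nat =>
                (-1) ^ ((k + 1) / 2)
                  / (INR (fact (p + m - k)) * (2 * PI * z) ^ k)
                  * Clausen (k + 1) (2 * PI * z))
              m (m + p)
            - kronecker (INR ((p + m) / 2)) (INR (p + m) / 2)
                * ((-1) ^ ((p + m) / 2) * zeta (INR (p + m + 1))
                     / (2 * PI * z) ^ (p + m)))
     - / (2 * z)
         * sum_n_m (fun k : nat =>
               (-1) ^ k * zeta (INR (2 * k + 1))
                 / (INR (fact (m - 1 - 2 * k)) * INR (m + p - 2 * k)
                      * (2 * PI * z) ^ (2 * k)))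
             1 ((m - 1) / 2)
     + (ln (2 * PI / z) + harmonic (m - 1))
         / (2 * z * INR (fact (m - 1)) * INR (p + m))
     + / (2 * z * INR (fact (m - 1)) * INR (p + m) ^ 2)
     - EulerMascheroni / (INR (fact m) * INR (p + m + 1))).
Proof.
  assert (Hz : 0 < z < 1) by lra.
  destruct m as [ | n]; [lia | ]. replace (S n - 1)%nat with n by lia.
  rewrite normalised_negapolygamma_sum, normalised_correction_sum by auto.
  rewrite Rmult_minus_distr_l, normalised_Clausen_sum by auto.
  rewrite by_parts_negapolygamma by auto.
  assert (HK := Clausen_moment_constant_eq p n).
  match goal with |- is_series _ ?r => replace r with (zeta_moment p n z / z ^ (p + n + 2)); [apply is_series_zeta_moment; auto | ] end.
  set (Z := zeta_moment p n z). set (B := by_parts p Clausen_chain (S n) z). set (Q := correction_moment p n z).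
  set (kr := kronecker (INR ((p + S n) / 2)) (INR (p + S n) / 2)) in *.
  set (ze := zeta (INR (p + S n + 1))) in *.
  rewrite (Rpow_mult_distr (2 * PI) z).
  replace ((-1) ^ S n * INR (fact p) / (2 * z) * (kr * ((-1) ^ ((p + S n) / 2) * ze / ((2 * PI) ^ (p + S n) * z ^ (p + S n)))))
    with (/ 2 * Clausen_moment_constant p n / z ^ (p + n + 2)).
  2:{ rewrite HK. replace (p + n + 2)%nat with (p + S n + 1)%nat by lia. rewrite (pow_add z (p + S n) 1), pow_1.
      generalize ((-1) ^ S n) ((-1) ^ ((p + S n) / 2)). intros w v. field.
      repeat split; try (apply pow_nonzero; lra); try lra. apply pow_nonzero, two_PI_nz. }
  unfold power_moment, log_moment, log_antiderivative.
  assert (HP := PI_RGT_0).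
  rewrite ln_div by lra.
  replace (p + S n)%nat with (S (p + n)) by lia.
  replace (S (p + n) + 1)%nat with (p + n + 2)%nat by lia.
  assert (F1 : INR (fact (S n)) <> 0) by apply INR_fact_neq_0.
  assert (F2 : INR (fact n) <> 0) by apply INR_fact_neq_0.
  assert (F3 : INR (S (p + n)) <> 0) by (apply not_0_INR; lia).
  assert (F4 : INR (p + n + 2) <> 0) by (apply not_0_INR; lia).
  assert (F5 : z ^ S (p + n) <> 0) by (apply pow_nonzero; lra).
  replace (S (S (p + n))) with (p + n + 2)%nat by lia.
  replace (z ^ (p + n + 2)) with (z ^ S (p + n) * z) by (replace (p + n + 2)%nat with (S (p + n) + 1)%nat by lia; rewrite (pow_add z (S (p + n)) 1), pow_1; reflexivity).
  set (x := z ^ S (p + n)) in *.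
  field. repeat split; auto; lra.
Qed.
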